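(* Let $r,r'\ge2$, $r+r'=n$, and $G_R=\mathrm{O}(r)\times\mathrm{O}(r')$. The second reduced space $\mathcal{R}=T^*\mathrm{S}^{n-1}/G_R$ is the semialgebraic variety consisting of those $(A,B,P,D)\in\mathbb{R}^4$ satisfying $$0\le A\le1,\quad 0\le B\le P,\quad D^2\le AB,\quad D^2\le(1-A)(P-B).$$ $\mathcal{R}$ has a natural stratification arising from the isotropy groups for the action of $G_R$ on $T^*\mathrm{S}^{n-1}$. The strata, listed as: name; quantities that vanish on the stratum in $T^*\mathrm{S}^{n-1}$; isotropy subgroup (up to conjugacy); equations of its image in $\mathcal{R}$, are - $S_0$: $q_1,p_1,p_2$; $\mathrm{O}(r)\times\mathrm{O}(r'-1)$; $A=B=P=D=0$. - $S_0'$: $q_2,p_1,p_2$; $\mathrm{O}(r-1)\times\mathrm{O}(r')$; $A=1,\ B=P=D=0$. - $S_1$: $q_1,p_1$; $\mathrm{O}(r)\times\mathrm{O}(r'-2)$; $A=B=D=0$. - $S_1'$: $q_2,p_2$; $\mathrm{O}(r-2)\times\mathrm{O}(r')$; $A=1,\ P-B=D=0$. - $S_2$: $q_1\wedge p_1,\ q_2\wedge p_2$; $\mathrm{O}(r-1)\times\mathrm{O}(r'-1)$; $D^2=AB=(1-A)(P-B)$. - $S_3$: $q_1\wedge p_1$; $\mathrm{O}(r-1)\times\mathrm{O}(r'-2)$; $D^2=AB$. - $S_3'$: $q_2\wedge p_2$; $\mathrm{O}(r-2)\times\mathrm{O}(r'-1)$; $D^2=(1-A)(P-B)$. - $S_4$: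 none; $\mathrm{O}(r-2)\times\mathrm{O}(r'-2)$; the rest of $\mathcal{R}$.
   Context: $T^*\mathrm{S}^{n-1}=\{(q,p)\in\mathbb{R}^n\times\mathbb{R}^n:\|q\|=1,\ q\cdot p=0\}$. Write $q=(q_1,q_2)$, $p=(p_1,p_2)\in\mathbb{R}^r\times\mathbb{R}^{r'}$. $G_R=\mathrm{O}(r)\times\mathrm{O}(r')$ acts by $(h_{11},h_{22})\cdot(q_1,q_2,p_1,p_2)=(h_{11}q_1,h_{22}q_2,h_{11}p_1,h_{22}p_2)$. (This is the symmetry group of the cylindrical Veselova top, with mass tensor $\mathbb{J}=\mathrm{diag}[J_1,\dots,J_1,J_2,\dots,J_2]$, $J_1\ne J_2$ of multiplicities $r$ and $r'$.) The orbit space $\mathcal{R}$ is identified with its image in $\mathbb{R}^4$ under the invariants $$A=\|q_1\|^2,\quad B=\|p_1\|^2,\quad P=\|p_1\|^2+\|p_2\|^2,\quad D=p_1\cdot q_1.$$ For $a,b\in\mathbb{R}^k$, $a\wedge b=ab^T-ba^T$ (it vanishes iff $a,b$ are linearly dependent). $\mathrm{O}(1)=\mathbb{Z}_2$ and $\mathrm{O}(0)$ is the trivial group. In the list, each stratum consists of the points satisfying the listed conditions that do not belong to any stratum with more restrictive conditions, i.e. the lower-dimensional strata in its closure are removed (e.g. $S_1$ is $A=B=D=0$ with the point $S_0$ removed, so $P>0$). *)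

(* Defs.v *)
(* MathComp-Analysis *)
From HB Require Import structures.
From mathcomp Require Import all_boot all_order all_algebra.
From mathcomp Require Import all_classical all_reals all_analysis.
Set Implicit Arguments.
Unset Strict Implicit.
Unset Printing Implicit Defensive.
Import Order.TTheory GRing.Theory Num.Theory.
Import numFieldNormedType.Exports.
Local Open Scope classical_set_scope.
Local Open Scope ring_scope.

Section Euclidean.
Variable R : realType.

Definition dot k (a b : 'cV[R]_k) : R := \sum_(i < k) a i 0 * b i 0.

(* The library norm on matrices is the sup norm, hence a separate Euclidean
   norm. *)
Definition enorm k (a : 'cV[R]_k) : R := Num.sqrt (dot a a).

Definition wedge k (a b : 'cV[R]_k) : 'M[R]_k := a *m b^T - b *m a^T.

Definition cotangent_sphere n : set ('cV[R]_n * 'cV[R]_n) :=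
  [set x | enorm x.1 = 1 /\ dot x.1 x.2 = 0].

Definition orthogonal_group k : set 'M[R]_k := [set h | h^T *m h = 1%:M].

(* O(k) inside O(m), for k <= m, as the matrices diag(1_(m-k), h).  The block
   matrix has size (m - k) + k, and conform_mx only transports it to size m
   (its default 1%:M is never used when k <= m). *)
Definition orthogonal_corner m k : set 'M[R]_m :=
  [set conform_mx (1%:M : 'M[R]_m)
         (block_mx (1%:M : 'M[R]_(m - k)) 0 0 h) | h in @orthogonal_group k].

End Euclidean.

Section Action.
Variables (R : realType) (r r' : nat).

Let phase : Type := ('cV[R]_(r + r') * 'cV[R]_(r + r'))%type.
Let G : Type := ('M[R]_r * 'M[R]_r')%type.

Definition q1 (x : phase) : 'cV[R]_r := usubmx x.1.
Definition q2 (x : phase) : 'cV[R]_r' := dsubmx x.1.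
Definition p1 (x : phase) : 'cV[R]_r := usubmx x.2.
Definition p2 (x : phase) : 'cV[R]_r' := dsubmx x.2.

Definition GR : set G := @orthogonal_group R r `*` @orthogonal_group R r'.

Definition act (h : G) (x : phase) : phase :=
  (col_mx (h.1 *m q1 x) (h.2 *m q2 x), col_mx (h.1 *m p1 x) (h.2 *m p2 x)).

Definition isotropy (x : phase) : set G := [set h | GR h /\ act h x = x].

Definition conjugate_subgroups (K H : set G) : Prop :=
  exists2 g, GR g &
    K = [set (g.1 *m h.1 *m invmx g.1, g.2 *m h.2 *m invmx g.2) | h in H].

Definition orbit_type (H : set G) : set phase :=
  [set x | cotangent_sphere x /\ conjugate_subgroups (isotropy x) H].

Definition row4 (a b c d : R) : 'rV[R]_4 := \row_i [:: a; b; c; d]`_i.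

Definition invariants (x : phase) : 'rV[R]_4 :=
  row4 (enorm (q1 x) ^+ 2) (enorm (p1 x) ^+ 2)
       (enorm (p1 x) ^+ 2 + enorm (p2 x) ^+ 2) (dot (p1 x) (q1 x)).

(* The map induced by [invariants] on the orbit space of the cotangent bundle
   of the sphere, with its quotient topology, is a homeomorphism onto Y: the
   image is Y, the fibres are the orbits, and Y (as a subspace of R^4) carries
   the quotient topology. *)
Definition identifies_orbit_space (Y : set 'rV[R]_4) : Prop :=
  [/\ invariants @` @cotangent_sphere R (r + r') = Y,
      forall x y : phase, cotangent_sphere x -> cotangent_sphere y ->
        (invariants x = invariants y <-> exists2 g, GR g & y = act g x)
    & forall V : set 'rV[R]_4, V `<=` Y ->
        (open (V : set (subspace Y)) <->
         open ((@cotangent_sphere R (r + r') `&` invariants @^-1` V)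
                : set (subspace (@cotangent_sphere R (r + r')))))].

End Action.

Section Stratification.
Variables (R : realType) (m : nat).

Fixpoint class_C (k : nat) (U : set 'rV[R]_m.+1) (f : 'rV[R]_m.+1 -> R) : Prop :=
  match k with
  | 0 => forall x, U x -> {for x, continuous f}
  | k'.+1 => (forall x, U x -> differentiable f x) /\
             forall v, class_C k' U (fun x => 'D_v f x)
  end.

Definition smooth (U : set 'rV[R]_m.+1) (f : 'rV[R]_m.+1 -> R) : Prop :=
  forall k, class_C k U f.

Definition jacobian_at c (f : 'I_c -> 'rV[R]_m.+1 -> R) (x : 'rV[R]_m.+1) :
    'M[R]_(c, m.+1) :=
  \matrix_(i, j) 'D_(delta_mx 0 j) (f i) x.

(* Embedded smooth submanifolds of dimension d, as local regular level sets. *)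
Definition submanifold (d : nat) (S : set 'rV[R]_m.+1) : Prop :=
  forall x, S x ->
    exists (c : nat) (f : 'I_c -> 'rV[R]_m.+1 -> R) (U : set 'rV[R]_m.+1),
      [/\ (d + c = m.+1)%N, open U /\ U x, forall i, smooth U (f i),
          row_free (jacobian_at f x)
        & S `&` U = [set y | U y /\ forall i, f i y = 0]].

(* Finite partition into nonempty smooth submanifolds with the frontier
   condition: a stratum meeting the closure of another one lies in this
   closure, and has smaller dimension. *)
Definition stratification (I : Type) (X : set 'rV[R]_m.+1)
    (S : I -> set 'rV[R]_m.+1) : Prop :=
  [/\ finite_set [set: I],
      \bigcup_i S i = X,
      trivIset [set: I] S
    & exists d : I -> nat,
        (forall i, S i !=set0 /\ submanifold (d i) (S i)) /\
        forall i j, i <> j -> S i `&` closure (S j) !=set0 ->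
          S i `<=` closure (S j) /\ (d i < d j)%N].

End Stratification.

Inductive stratum := S0 | S0' | S1 | S1' | S2 | S3 | S3' | S4.

Definition isotropy_type (R : realType) (r r' : nat) (s : stratum) :
    set ('M[R]_r * 'M[R]_r') :=
  let O k l := @orthogonal_corner R r k `*` @orthogonal_corner R r' l in
  match s with
  | S0  => O r (r' - 1)%N
  | S0' => O (r - 1)%N r'
  | S1  => O r (r' - 2)%N
  | S1' => O (r - 2)%N r'
  | S2  => O (r - 1)%N (r' - 1)%N
  | S3  => O (r - 1)%N (r' - 2)%N
  | S3' => O (r - 2)%N (r' - 1)%N
  | S4  => O (r - 2)%N (r' - 2)%N
  end.

(* From a family of sets of points cut out by lists of conditions: the points
   satisfying the conditions of s, but not those of any more restrictive t. *)
Definition remove_smaller T (V : stratum -> set T) (s : stratum) : set T :=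
  V s `\` \bigcup_(t in [set t | V t `<` V s]) V t.

Definition vanishing_locus (R : realType) (r r' : nat) (s : stratum) :
    set ('cV[R]_(r + r') * 'cV[R]_(r + r')) :=
  [set x | cotangent_sphere x /\
    match s with
    | S0  => [/\ q1 x = 0, p1 x = 0 & p2 x = 0]
    | S0' => [/\ q2 x = 0, p1 x = 0 & p2 x = 0]
    | S1  => q1 x = 0 /\ p1 x = 0
    | S1' => q2 x = 0 /\ p2 x = 0
    | S2  => wedge (q1 x) (p1 x) = 0 /\ wedge (q2 x) (p2 x) = 0
    | S3  => wedge (q1 x) (p1 x) = 0
    | S3' => wedge (q2 x) (p2 x) = 0
    | S4  => True
    end].

Section Image.
Variable R : realType.

Definition coordA (y : 'rV[R]_4) : R := y ord0 (@Ordinal 4 0 isT).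
Definition coordB (y : 'rV[R]_4) : R := y ord0 (@Ordinal 4 1 isT).
Definition coordP (y : 'rV[R]_4) : R := y ord0 (@Ordinal 4 2 isT).
Definition coordD (y : 'rV[R]_4) : R := y ord0 (@Ordinal 4 3 isT).

Definition reduced_space : set 'rV[R]_4 :=
  [set y | let A := coordA y in let B := coordB y in
           let P := coordP y in let D := coordD y in
    [/\ 0 <= A <= 1, 0 <= B <= P, D ^+ 2 <= A * B
      & D ^+ 2 <= (1 - A) * (P - B)]].

Definition image_locus (s : stratum) : set 'rV[R]_4 :=
  [set y | reduced_space y /\
    let A := coordA y in let B := coordB y in
    let P := coordP y in let D := coordD y in
    match s with
    | S0  => [/\ A = 0, B = 0, P = 0 & D = 0]
    | S0' => [/\ A = 1, B = 0, P = 0 & D = 0]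
    | S1  => [/\ A = 0, B = 0 & D = 0]
    | S1' => [/\ A = 1, P - B = 0 & D = 0]
    | S2  => D ^+ 2 = A * B /\ A * B = (1 - A) * (P - B)
    | S3  => D ^+ 2 = A * B
    | S3' => D ^+ 2 = (1 - A) * (P - B)
    | S4  => True
    end].

End Image.

Definition phase_stratum (R : realType) (r r' : nat) :=
  remove_smaller (@vanishing_locus R r r').

Definition image_stratum (R : realType) := remove_smaller (@image_locus R).

(* Main.v *)
Require Import Defs.
From HB Require Import structures.
From mathcomp Require Import all_boot all_order all_algebra.
From mathcomp Require Import all_classical all_reals all_analysis.
From mathcomp Require Import ring lra.
Set Implicit Arguments.
Unset Strict Implicit.
Unset Printing Implicit Defensive.
Import Order.TTheory GRing.Theory Num.Theory.
Import numFieldNormedType.Exports.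
Local Open Scope classical_set_scope.
Local Open Scope ring_scope.

(** Put [M1 = [[A, D], [D, B]]] and [M2 = [[1 - A, - D], [- D, P - B]]].  At the
    point with invariants [(A, B, P, D)], these are the Gram matrices of the
    pairs [(q1, p1)] and [(q2, p2)]: the two equations of the cotangent bundle
    of the sphere say precisely that [M1 + M2 = diag(1, P)].  So the reduced
    space is the set of [(A, B, P, D)] with [M1] and [M2] positive semidefinite,
    and every notion of the theorem is a matter of the two ranks, which run
    over all pairs of numbers at most 2 except [(0, 0)].  The eight strata are
    the eight pairs ([stratum_ranks]), and more restrictive conditions mean
    smaller ranks ([image_locusE], [vanishing_locusE]).

    Orbits.  Two pairs of vectors with the same Gram matrix differ by an
    orthogonal transformation, a product of two reflections ([gram_orbit]).
    The orbits are thus the fibres of the invariants.  The symmetric square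
    roots of [M1] and [M2] provide a continuous section of the invariants over
    the reduced space ([root_sectionK], [continuous_root_section]); it shows
    that the image is the whole reduced space, and that a subset of the reduced
    space with open preimage is open.

    Isotropy.  A pair of vectors of rank [i] in dimension [k] is fixed by the
    orthogonal group of a complement of dimension [k - i], a conjugate of
    [O(k - i)] ([pair_stabilizer_conj]); the dimension is determined by the
    conjugacy class ([conj_corner_inj]).  Hence the isotropy type of a point is
    equivalent to its two ranks.

    Stratification.  Each stratum is cut out, in an open set defined by strict
    polynomial inequalities, by polynomials with independent differentials
    ([submanifold_stratum]).  Ranks can only drop in the limit
    ([frontier_ranks]), and conversely a segment in the convex reduced space
    raises the rank of either form without changing that of the other
    ([rank_stratum_closure]), which gives the frontier condition. *)

(** * Positive semidefinite binary forms *)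

Section BinaryForms.
Variable R : realType.
Implicit Types a b d t : R.

(** Trace and determinant of the symmetric matrix [[a, d], [d, b]]. *)
Definition psd a b d := (0 <= a + b) /\ (d ^+ 2 <= a * b).

(** For a positive semidefinite form this is the rank of its matrix: a positive
    determinant forces a positive trace.  Both conditions are open, which makes
    semicontinuity of the rank immediate. *)
Definition form_rank a b d : nat := (0 < a + b)%R + (d ^+ 2 < a * b)%R.

Lemma psdE a b d : psd a b d <-> [/\ 0 <= a, 0 <= b & d ^+ 2 <= a * b].
Proof.
split=> [[ab dab]|[a0 b0 dab]]; last by split=> //; lra.
have d0 : 0 <= d ^+ 2 := sqr_ge0 d.
split=> //.
- by case: (leP 0 a) => // a0; nra.
- by case: (leP 0 b) => // b0; nra.
Qed.

Lemma form_rank_le2 a b d : (form_rank a b d <= 2)%N.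
Proof. by rewrite /form_rank; case: (_ < _); case: (_ < _). Qed.

Lemma form_rank_eq0 a b d : psd a b d ->
  (form_rank a b d <= 0)%N <-> [/\ a = 0, b = 0 & d = 0].
Proof.
move=> /psdE[a0 b0 dab]; rewrite /form_rank; split; last first.
  by move=> [-> -> ->]; rewrite addr0 mulr0 expr0n /= ltxx.
have [|ab _] := ltP 0 (a + b); first by [].
have ea : a = 0 by lra.
have eb : b = 0 by lra.
split=> //; apply/eqP; rewrite -sqrf_eq0; apply/eqP.
by move: dab (sqr_ge0 d); rewrite ea mul0r; lra.
Qed.

Lemma form_rank_le1 a b d : psd a b d ->
  (form_rank a b d <= 1)%N <-> d ^+ 2 = a * b.
Proof.
move=> /psdE[a0 b0 dab]; rewrite /form_rank.
have [dlt|dge] := ltP (d ^+ 2) (a * b).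
  have d0 := sqr_ge0 d.
  have -> : 0 < a + b.
    have [e|an0] := eqVneq a 0; first by move: dlt; rewrite ?e mul0r; lra.
    by rewrite ltr_wpDr // lt_def an0.
  by split=> // e; lra.
by split=> _; [lra|rewrite addn0; case: (_ < _)].
Qed.

Lemma form_rank2 a b d : psd a b d -> d ^+ 2 < a * b -> form_rank a b d = 2%N.
Proof.
move=> p lt; have := form_rank_le1 p; have := form_rank_le2 a b d.
case: (form_rank a b d) => [|[|[|]]] // _ [/(_ isT) e];
  by move: lt; rewrite e ltxx.
Qed.

Lemma psd_scale t a b d : 0 < t -> psd a b d ->
  psd (t * a) (t * b) (t * d) /\
  form_rank (t * a) (t * b) (t * d) = form_rank a b d.
Proof.
move=> t0 p.
have t20 : 0 < t ^+ 2 by rewrite exprn_gt0.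
have e1 : t * a + t * b = t * (a + b) by ring.
have e2 : (t * d) ^+ 2 = t ^+ 2 * d ^+ 2 by ring.
have e3 : t * a * (t * b) = t ^+ 2 * (a * b) by ring.
rewrite /psd /form_rank e1 e2 e3 pmulr_rgt0 // pmulr_rge0 //.
by rewrite ler_pM2l // ltr_pM2l.
Qed.

Lemma psd_add_diag a b d u v : 0 < u -> 0 < v -> psd a b d ->
  psd (a + u) (b + v) d /\ form_rank (a + u) (b + v) d = 2%N.
Proof.
move=> u0 v0 /psdE[a0 b0 dab].
have lt : d ^+ 2 < (a + u) * (b + v) by nra.
have p : psd (a + u) (b + v) d by split; [lra|exact: ltW].
by split=> //; exact: form_rank2.
Qed.

End BinaryForms.

(** * Gram matrices of pairs of vectors *)
Section Gram.
Variable R : realType.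

Section Dot.
Variable k : nat.
Implicit Types a b c : 'cV[R]_k.

Lemma dotE a b : dot a b = (a^T *m b) 0 0.
Proof. by rewrite mxE; apply: eq_bigr => i _; rewrite mxE. Qed.

Lemma dot_mxE a b : a^T *m b = (dot a b)%:M.
Proof. by rewrite [LHS]mx11_scalar -dotE. Qed.

Lemma dotC a b : dot a b = dot b a.
Proof. by apply: eq_bigr => i _; rewrite mulrC. Qed.

Lemma dotDl a b c : dot (a + b) c = dot a c + dot b c.
Proof. by rewrite !dotE linearD mulmxDl mxE. Qed.

Lemma dotZl t a c : dot (t *: a) c = t * dot a c.
Proof. by rewrite !dotE linearZ -scalemxAl mxE. Qed.

Lemma dotDr a b c : dot c (a + b) = dot c a + dot c b.
Proof. by rewrite ![dot c _]dotC dotDl. Qed.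

Lemma dotZr t a c : dot c (t *: a) = t * dot c a.
Proof. by rewrite ![dot c _]dotC dotZl. Qed.

Lemma dotNl a c : dot (- a) c = - dot a c.
Proof. by rewrite -scaleN1r dotZl mulN1r. Qed.

Lemma dotNr a c : dot c (- a) = - dot c a.
Proof. by rewrite ![dot c _]dotC dotNl. Qed.

Lemma dot0l a : dot 0 a = 0.
Proof. by rewrite -(scale0r 0) dotZl mul0r. Qed.

Lemma dot0r a : dot a 0 = 0.
Proof. by rewrite dotC dot0l. Qed.

Lemma dot_ge0 a : 0 <= dot a a.
Proof. by apply: sumr_ge0 => i _; rewrite -expr2 sqr_ge0. Qed.

Lemma dot_eq0 a : dot a a = 0 -> a = 0.
Proof.
move=> e; apply/matrixP=> i j; rewrite ord1 mxE; apply/eqP.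
have /eqP := e; rewrite psumr_eq0; last by move=> m _; rewrite -expr2 sqr_ge0.
by move=> /allP/(_ i (mem_index_enum i)); rewrite -expr2 sqrf_eq0.
Qed.

Lemma dot_orth (h : 'M[R]_k) a b :
  orthogonal_group h -> dot (h *m a) (h *m b) = dot a b.
Proof.
by move=> hh; rewrite !dotE trmx_mul -mulmxA (mulmxA _ h) hh mul1mx.
Qed.

Lemma enorm_sqr a : enorm a ^+ 2 = dot a a.
Proof. by rewrite /enorm sqr_sqrtr // dot_ge0. Qed.

Lemma enorm_eq1 a : enorm a = 1 <-> dot a a = 1.
Proof.
split=> [e|e]; first by rewrite -enorm_sqr e expr1n.
by rewrite /enorm e sqrtr1.
Qed.

(** Lagrange's identity; it yields the Cauchy--Schwarz inequality together with
    its equality case. *)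
Lemma wedge_sqr a b : \sum_i \sum_j wedge a b i j ^+ 2 =
  2 * (dot a a * dot b b - dot a b ^+ 2).
Proof.
have dd (u v w z : 'cV[R]_k) :
    dot u v * dot w z = \sum_i \sum_j (u i 0 * v i 0) * (w j 0 * z j 0).
  by rewrite /dot mulr_suml; apply: eq_bigr => i _; rewrite mulr_sumr.
have -> : 2 * (dot a a * dot b b - dot a b ^+ 2) =
  dot a a * dot b b + dot b b * dot a a - 2 * (dot a b * dot a b) by ring.
rewrite !dd mulr_sumr -big_split -sumrB /=; apply: eq_bigr => i _.
rewrite mulr_sumr -big_split -sumrB /=; apply: eq_bigr => j _.
by rewrite !mxE !big_ord1 !mxE; ring.
Qed.

Lemma psd_gram a b : psd (dot a a) (dot b b) (dot a b).
Proof.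
split; first by rewrite addr_ge0 // dot_ge0.
suff : 0 <= 2 * (dot a a * dot b b - dot a b ^+ 2) by lra.
rewrite -wedge_sqr; apply: sumr_ge0 => i _; apply: sumr_ge0 => j _.
exact: sqr_ge0.
Qed.

Lemma wedge_eq0 a b : wedge a b = 0 <-> dot a b ^+ 2 = dot a a * dot b b.
Proof.
have H := wedge_sqr a b; split=> [w0|e].
  move: H; rewrite w0 big1 => [|i _]; first by lra.
  by rewrite big1 // => j _; rewrite mxE expr0n.
move: H; rewrite e subrr mulr0 => /eqP.
have s0 i : 0 <= \sum_j wedge a b i j ^+ 2.
  by apply: sumr_ge0 => j _; exact: sqr_ge0.
rewrite psumr_eq0 // => /allP z; apply/matrixP => i j.
have /eqP/= := z i (mem_index_enum i) => /eqP.
rewrite psumr_eq0 => [|m _]; last exact: sqr_ge0.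
move=> /allP/(_ j (mem_index_enum j)); rewrite sqrf_eq0 => /eqP ->.
by rewrite mxE.
Qed.

End Dot.

Lemma dot_col_mx m n (a b : 'cV[R]_m) (c d : 'cV[R]_n) :
  dot (col_mx a c) (col_mx b d) = dot a b + dot c d.
Proof. by rewrite !dotE tr_col_mx mul_row_col mxE. Qed.

Section Orthogonal.
Variable k : nat.
Implicit Types (a b c : 'cV[R]_k) (g h : 'M[R]_k).

Lemma orthogonal1 : orthogonal_group (1%:M : 'M[R]_k).
Proof. by rewrite /orthogonal_group /= trmx1 mul1mx. Qed.

Lemma orthogonalM g h :
  orthogonal_group g -> orthogonal_group h -> orthogonal_group (g *m h).
Proof.
rewrite /orthogonal_group /= => eg eh.
by rewrite trmx_mul -mulmxA (mulmxA g^T) eg mul1mx.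
Qed.

Lemma orthogonalV g : orthogonal_group g ->
  [/\ g \in unitmx, invmx g = g^T & orthogonal_group (invmx g)].
Proof.
move=> gg; have ug : g \in unitmx by have [] := mulmx1_unit gg.
have e : invmx g = g^T by rewrite -[RHS](mulmxK ug) gg mul1mx.
by split=> //; rewrite /orthogonal_group /= e trmxK -e mulmxV.
Qed.

Definition reflection c : 'M[R]_k := 1%:M - (2 / dot c c) *: (c *m c^T).

Lemma reflectionE c a : reflection c *m a = a - (2 * dot c a / dot c c) *: c.
Proof.
rewrite mulmxBl mul1mx -scalemxAl -mulmxA dot_mxE mul_mx_scalar scalerA.
by congr (_ - _ *: _); ring.
Qed.

Lemma reflection_orthogonal c : orthogonal_group (reflection c).
Proof.
rewrite /orthogonal_group /=.
have -> : (reflection c)^T = reflection c.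
  by rewrite linearB /= trmx1 linearZ /= trmx_mul trmxK.
have [->|c0] := eqVneq c 0.
  by rewrite /reflection mul0mx scaler0 subr0 mulmx1.
have d0 : dot c c != 0 by apply: contra c0 => /eqP/dot_eq0 ->.
apply/eqP; rewrite -subr_eq0 {2}/reflection mulmxBr mulmx1 -scalemxAr mulmxA.
rewrite reflectionE mulmxBl -scalemxAl scalerBr scalerA {1}/reflection.
have -> : 2 / dot c c * (2 * dot c c / dot c c) = 2 / dot c c + 2 / dot c c.
  by field.
rewrite scalerDl; set u := _ *: _; apply/eqP.
by rewrite opprB !addrA addrNK addrK subrr.
Qed.

Lemma reflection_swap a b : dot a a = dot b b -> reflection (b - a) *m a = b.
Proof.
move=> e; rewrite reflectionE.
have [ba|ne] := eqVneq b a; first by rewrite ba subrr scaler0 subr0.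
have d0 : dot (b - a) (b - a) != 0.
  by apply: contra ne => /eqP/dot_eq0/eqP; rewrite subr_eq0.
have -> : 2 * dot (b - a) a / dot (b - a) (b - a) = -1.
  apply: (mulIf d0); rewrite divfK // ?dotDl ?dotDr ?dotNl ?dotNr e (dotC b a).
  by ring.
by rewrite scaleN1r opprK addrC subrK.
Qed.

(** Witt's theorem for two vectors: one reflection adjusts [a], and a second
    one adjusts [b]; the latter fixes the image of [a], because it is along a
    vector orthogonal to it. *)
Lemma gram_orbit a b a' b' :
  dot a a = dot a' a' -> dot b b = dot b' b' -> dot a b = dot a' b' ->
  exists2 h, orthogonal_group h & a' = h *m a /\ b' = h *m b.
Proof.
move=> ea eb eab; set s := reflection (a' - a).
have os : orthogonal_group s := reflection_orthogonal _.
have sa : s *m a = a' by exact: reflection_swap.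
exists (reflection (b' - s *m b) *m s).
  by apply: orthogonalM => //; exact: reflection_orthogonal.
rewrite -!mulmxA sa reflection_swap ?dot_orth //; split=> //.
rewrite reflectionE dotDl dotNl -[in X in dot (s *m b) X]sa dot_orth //.
by rewrite (dotC b') (dotC b) eab subrr mulr0 mul0r scale0r subr0.
Qed.

End Orthogonal.
End Gram.

(** * The subgroups O(k) and their conjugates *)
Section Corners.
Variable R : realType.

Lemma orthogonal_corner_block i l :
  @orthogonal_corner R (i + l) l =
  [set block_mx 1%:M 0 0 h | h in @orthogonal_group R l].
Proof.
suff H j : j = i ->
    [set conform_mx (1%:M : 'M[R]_(i + l))
       (block_mx (1%:M : 'M[R]_j) 0 0 h) | h in @orthogonal_group R l] =
    [set block_mx (1%:M : 'M[R]_i) 0 0 h | h in @orthogonal_group R l].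
  exact/H/addnK.
by move=> ->; apply: eq_imagel => h _; rewrite conform_mx_id.
Qed.

(** A matrix fixing the first [i] basis vectors has no lower left block; its
    transpose fixes them too, being its inverse, so there is no upper right
    block either. *)
Lemma orthogonal_cornerP k i (h : 'M[R]_k) : (i <= k)%N ->
  orthogonal_corner (k - i) h <->
  orthogonal_group h /\ h *m pid_mx i = pid_mx i :> 'M[R]_k.
Proof.
move=> ik; have := subnKC ik; set l := (k - i)%N => e; clearbody l; subst k.
rewrite orthogonal_corner_block pid_mx_block; split.
  move=> [g og <-]; rewrite /orthogonal_group /= tr_block_mx.
  rewrite !mulmx_block !(trmx1, trmx0, mul0mx, mulmx0, mul1mx, addr0, add0r) og.
  by rewrite scalar_mx_block.
move=> [oh hE].
have := congr1 (mulmx h^T) hE; rewrite mulmxA oh mul1mx => htE.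
move: oh hE htE; rewrite -[h]submxK /orthogonal_group /=.
set h1 := ulsubmx h; set h2 := ursubmx h; set h3 := dlsubmx h.
set h4 := drsubmx h => oh; move: (oh).
rewrite tr_block_mx !mulmx_block !(mul0mx, mulmx0, mulmx1, addr0, add0r).
move=> oh' /eq_block_mx[e1 _ e3 _] /eq_block_mx[_ _ e2 _].
have {}e2 : h2 = 0 by rewrite -[h2]trmxK -e2 trmx0.
exists h4; last by rewrite e1 e2 e3.
move: oh'; rewrite e1 e2 e3.
rewrite !(trmx1, trmx0, mul0mx, mulmx0, mul1mx, addr0, add0r).
by rewrite scalar_mx_block => /eq_block_mx[_ _ _].
Qed.

Lemma corner_rank k l (h : 'M[R]_k) : (l <= k)%N ->
  orthogonal_corner l h -> (\rank (h - 1%:M)%R <= l)%N.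
Proof.
move=> /subnK e; move: (k - l)%N e h => i e; subst k => h.
rewrite orthogonal_corner_block => -[g _ <-].
rewrite scalar_mx_block opp_block_mx add_block_mx !(subrr, oppr0, addr0).
by rewrite rank_diag_block_mx mxrank0 rank_leq_row.
Qed.

Lemma corner_rank_witness k l : (l <= k)%N ->
  exists2 h : 'M[R]_k, orthogonal_corner l h & \rank (h - 1%:M) = l.
Proof.
move=> /subnK e; move: (k - l)%N e => i e; subst k.
exists (block_mx 1%:M 0 0 (-1)%:M).
  rewrite orthogonal_corner_block; exists (-1)%:M => //.
  by rewrite /orthogonal_group /= tr_scalar_mx -scalar_mxM mulrNN mulr1.
rewrite (scalar_mx_block i l 1) opp_block_mx add_block_mx.
rewrite !(subrr, oppr0, addr0).
rewrite rank_diag_block_mx mxrank0 add0n -raddfB /= -scalemx1.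
by rewrite mxrank_scale_nz ?mxrank1 // -opprD oppr_eq0 (pnatr_eq0 R 2).
Qed.

Definition conj_set k (g : 'M[R]_k) (H : set 'M[R]_k) : set 'M[R]_k :=
  [set g *m h *m invmx g | h in H].

Lemma rank_conj k (g h : 'M[R]_k) : g \in unitmx ->
  \rank (g *m h *m invmx g - 1%:M) = \rank (h - 1%:M).
Proof.
move=> ug; have -> : g *m h *m invmx g - 1%:M = g *m (h - 1%:M) *m invmx g.
  by rewrite mulmxBr mulmxBl mulmx1 mulmxV.
rewrite mxrankMfree ?row_free_unit ?unitmx_inv //.
by rewrite (eqmxMfull _ _) // row_full_unit.
Qed.

(** The size of a corner is a conjugacy invariant: it is the largest rank of
    [h - 1] for [h] in the corner, attained at [diag(1, -1)]. *)
Lemma conj_corner_inj k l l' (g g' : 'M[R]_k) : (l <= k)%N -> (l' <= k)%N ->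
  g \in unitmx -> g' \in unitmx ->
  conj_set g (orthogonal_corner l) = conj_set g' (orthogonal_corner l') ->
  l = l'.
Proof.
have le m m' (f f' : 'M[R]_k) : (m <= k)%N -> (m' <= k)%N ->
    f \in unitmx -> f' \in unitmx ->
    conj_set f (orthogonal_corner m) = conj_set f' (orthogonal_corner m') ->
    (m <= m')%N.
  move=> mk mk' uf uf' E.
  have [h ch hm] := corner_rank_witness mk.
  have : conj_set f (orthogonal_corner m) (f *m h *m invmx f) by exists h.
  rewrite E => -[h' ch' eh']; rewrite -[X in (X <= _)%N]hm.
  by rewrite -(rank_conj h uf) -eh' rank_conj //; exact: corner_rank.
move=> lk lk' ug ug' E; apply/eqP.
by rewrite eqn_leq (le _ _ g g') // (le _ _ g' g).
Qed.

Lemma corner1 k l : (l <= k)%N -> orthogonal_corner l (1%:M : 'M[R]_k).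
Proof.
move=> lk; rewrite -[l](subKn lk) orthogonal_cornerP ?leq_subr //.
by split; [exact: orthogonal1|rewrite mul1mx].
Qed.

End Corners.

(** * Stabilizers of pairs of vectors *)
Section Stabilizers.
Variable R : realType.

Definition pair_stabilizer k (a b : 'cV[R]_k) : set 'M[R]_k :=
  [set h | orthogonal_group h /\ (h *m a = a /\ h *m b = b)].

Definition pair_rank k (a b : 'cV[R]_k) : nat :=
  form_rank (dot a a) (dot b b) (dot a b).

Lemma fix_scale k (h : 'M[R]_k) (t : R) (a : 'cV[R]_k) : t != 0 ->
  h *m (t *: a) = t *: a <-> h *m a = a.
Proof.
move=> t0; rewrite -scalemxAr; split=> [|->] //.
exact: scalerI.
Qed.

Lemma normalize k (a : 'cV[R]_k) : dot a a != 0 ->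
  exists2 t : R, t != 0 & dot (t *: a) (t *: a) = 1.
Proof.
move=> a0; exists (Num.sqrt (dot a a))^-1.
  by rewrite invr_eq0 sqrtr_eq0 -ltNge lt_def a0 dot_ge0.
by rewrite dotZl dotZr mulrA -expr2 exprVn sqr_sqrtr ?dot_ge0 // mulVf.
Qed.

(* The columns of this matrix are the first [i] basis vectors, then zeros. *)
Local Notation pid k i := (pid_mx i : 'M[R]_k).
Lemma fix_frame k (g h : 'M[R]_k) i :
  h *m (g *m pid k i) = g *m pid k i <->
  forall j : 'I_k, (j < i)%N ->
    h *m (g *m delta_mx j (0 : 'I_1)) = g *m delta_mx j 0.
Proof.
have E (j : 'I_k) : (pid_mx i : 'M[R]_k) *m delta_mx j (0 : 'I_1) =
    if (j < i)%N then delta_mx j 0 else 0.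
  rewrite -colE; apply/matrixP => m z; rewrite ord1 !mxE.
  have [->|ne] := eqVneq m j.
    by rewrite eqxx; case: ifP => _; rewrite !mxE ?eqxx.
  rewrite (inj_eq val_inj) (negbTE ne) /=.
  by case: ifP => _; rewrite !mxE ?(negbTE ne).
split=> [e j ji|e].
  by have := congr1 (mulmx^~ (delta_mx j (0 : 'I_1))) e; rewrite -!mulmxA E ji.
apply/matrixP => m j.
suff /matrixP/(_ m 0) : col j (h *m (g *m pid k i)) = col j (g *m pid k i).
  by rewrite !mxE.
rewrite !colE -!mulmxA E; case: ifP => ji; first exact: e.
by rewrite !mulmx0.
Qed.

(** Gram--Schmidt: the vectors fixed with [a] and [b] contain an orthonormal
    frame of their span, which is the image of the standard one. *)
Lemma pair_frame k (a b : 'cV[R]_k) : (2 <= k)%N ->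
  exists2 g, orthogonal_group g & forall h : 'M[R]_k,
    (h *m a = a /\ h *m b = b) <->
    h *m (g *m pid k (pair_rank a b)) = g *m pid k (pair_rank a b).
Proof.
case: k a b => [|[|k]] // a b _.
pose e0 : 'cV[R]_k.+2 := delta_mx 0 0; pose e1 : 'cV[R]_k.+2 := delta_mx 1 0.
have d0 : dot e0 e0 = 1.
  rewrite /dot (bigD1 0) //= big1 ?addr0 => [|i /negbTE ni].
    by rewrite !mxE mulr1.
  by rewrite !mxE ni mul0r.
have d1 : dot e1 e1 = 1.
  rewrite /dot (bigD1 1) //= big1 ?addr0 => [|i /negbTE ni].
    by rewrite !mxE mulr1.
  by rewrite !mxE ni mul0r.
have d01 : dot e0 e1 = 0.
  rewrite /dot big1 // => i _; rewrite !mxE.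
  by have [->|_] := eqVneq i 0; rewrite ?mulr0 ?mul0r.
have frame0 : (forall h : 'M[R]_k.+2, h *m a = a /\ h *m b = b) ->
    exists2 g, orthogonal_group g & forall h : 'M[R]_k.+2,
    (h *m a = a /\ h *m b = b) <-> h *m (g *m pid k.+2 0) = g *m pid k.+2 0.
  move=> H; exists 1%:M; first exact: orthogonal1.
  by move=> h; rewrite fix_frame; split.
have frame1 u : dot u u = 1 ->
    (forall h : 'M[R]_k.+2, (h *m a = a /\ h *m b = b) <-> h *m u = u) ->
    exists2 g, orthogonal_group g & forall h : 'M[R]_k.+2,
    (h *m a = a /\ h *m b = b) <-> h *m (g *m pid k.+2 1) = g *m pid k.+2 1.
  move=> du H; have [||| g og [gu _]] := @gram_orbit R _ e0 0 u 0.
  - by rewrite du.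
  - by rewrite !dot0l.
  - by rewrite !dot0r.
  exists g => // h; rewrite H fix_frame gu; split; last exact.
  move=> e j; rewrite ltnS leqn0 => /eqP j0.
  by have -> : j = 0 by exact: val_inj.
have frame2 u v : dot u u = 1 -> dot v v = 1 -> dot u v = 0 ->
    (forall h : 'M[R]_k.+2, (h *m a = a /\ h *m b = b) <->
                            (h *m u = u /\ h *m v = v)) ->
    exists2 g, orthogonal_group g & forall h : 'M[R]_k.+2,
    (h *m a = a /\ h *m b = b) <-> h *m (g *m pid k.+2 2) = g *m pid k.+2 2.
  move=> du dv duv H; have [||| g og [gu gv]] := @gram_orbit R _ e0 e1 u v.
  - by rewrite du.
  - by rewrite dv.
  - by rewrite duv.
  exists g => // h; rewrite H fix_frame gu gv; split; last first.
    by move=> e; split; exact: e.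
  move=> [eu ev] j; rewrite ltnS leq_eqVlt ltnS leqn0 => /orP[] /eqP j0.
    by have -> : j = 1 by exact: val_inj.
  by have -> : j = 0 by exact: val_inj.
have p := psd_gram a b.
have aa := dot_ge0 a; have bb := dot_ge0 b; have [_ dab] := p.
have [/dot_eq0 a0|a0] := eqVneq (dot a a) 0.
  subst a; have [/dot_eq0 b0|b0] := eqVneq (dot b b) 0.
    subst b; rewrite /pair_rank /form_rank !dot0r addr0 mulr0 expr0n /= ltxx.
    by apply: frame0 => h; rewrite mulmx0.
  have -> : pair_rank 0 b = 1%N.
    rewrite /pair_rank /form_rank !dot0r dot0l add0r mul0r expr0n /= ltxx addn0.
    by rewrite lt_def b0 bb.
  have [t t0 dt] := normalize b0.
  apply: (frame1 (t *: b) dt) => h.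
  by rewrite mulmx0 fix_scale //; split=> [[]|].
have [t t0 dt] := normalize a0.
pose c := dot a b / dot a a; pose w := b - c *: a.
have dw : dot w w = (dot a a * dot b b - dot a b ^+ 2) / dot a a.
  rewrite /w !(dotDl, dotDr, dotNl, dotNr, dotZl, dotZr) (dotC b a) /c.
  by field.
have daw : dot a w = 0.
  rewrite /w !(dotDl, dotDr, dotNl, dotNr, dotZl, dotZr) /c.
  by field.
have fw h : h *m a = a -> h *m b = b <-> h *m w = w.
  move=> ha; rewrite /w mulmxBr -scalemxAr ha.
  by split=> [->|/addIr].
have a1 : 0 < dot a a by rewrite lt_def a0.
have [lt|ge] := ltP (dot a b ^+ 2) (dot a a * dot b b).
  have w0 : dot w w != 0.
    by rewrite dw mulf_eq0 negb_or invr_eq0 a0 andbT subr_eq0 gt_eqF.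
  have [s s0 ds] := normalize w0.
  rewrite /pair_rank (form_rank2 p lt).
  apply: (frame2 (t *: a) (s *: w)) => //.
    by rewrite dotZl dotZr daw !mulr0.
  by move=> h; rewrite !fix_scale //; split=> -[ha hb]; split=> //; apply/fw.
have w0 : w = 0 by apply: dot_eq0; rewrite dw (_ : _ - _ = 0) ?mul0r //; lra.
have -> : pair_rank a b = 1%N.
  by rewrite /pair_rank /form_rank ltr_wpDr // ltNge ge.
apply: (frame1 (t *: a)) => // h; rewrite fix_scale //.
by split=> [[]|ha] //; split=> //; apply/fw; rewrite // w0 mulmx0.
Qed.

Lemma pair_rank_le2 k (a b : 'cV[R]_k) : (pair_rank a b <= 2)%N.
Proof. exact: form_rank_le2. Qed.

Lemma pair_stabilizer_conj k (a b : 'cV[R]_k) : (2 <= k)%N ->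
  exists2 g, orthogonal_group g &
    pair_stabilizer a b = conj_set g (orthogonal_corner (k - pair_rank a b)).
Proof.
move=> k2; have [g og H] := pair_frame a b k2; exists g => //.
have ik := leq_trans (pair_rank_le2 a b) k2.
have [ug gT oV] := orthogonalV og.
apply/seteqP; split=> [h [oh /H hg]|_ [h /(orthogonal_cornerP _ ik)[oh he] <-]].
  exists (invmx g *m h *m g); last by rewrite !mulmxA mulmxV // mul1mx mulmxK.
  apply/(orthogonal_cornerP _ ik).
  split; first by do 2?apply: orthogonalM.
  by rewrite -!mulmxA hg mulKmx.
split; first by do 2?apply: orthogonalM.
by apply/H; rewrite -!mulmxA mulKmx // he.
Qed.

End Stabilizers.

(** * Smooth submanifolds cut out by polynomials *)
Section Polynomials.
Variables (R : realType) (m : nat).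

(** Syntactic polynomials, so that partial derivatives are computed by
    reduction, and smoothness to every order is an induction. *)
Inductive pexpr :=
  | PCst of R
  | PVar of 'I_m.+1
  | PAdd of pexpr & pexpr
  | PMul of pexpr & pexpr.

Fixpoint peval (e : pexpr) (x : 'rV[R]_m.+1) : R :=
  match e with
  | PCst c => c
  | PVar i => x 0 i
  | PAdd e1 e2 => peval e1 x + peval e2 x
  | PMul e1 e2 => peval e1 x * peval e2 x
  end.

Fixpoint pderive (v : 'rV[R]_m.+1) (e : pexpr) : pexpr :=
  match e with
  | PCst _ => PCst 0
  | PVar i => PCst (v 0 i)
  | PAdd e1 e2 => PAdd (pderive v e1) (pderive v e2)
  | PMul e1 e2 => PAdd (PMul e1 (pderive v e2)) (PMul e2 (pderive v e1))
  end.

Lemma differentiable_peval e x : differentiable (peval e) x.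
Proof.
elim: e => [c|i|e1 h1 e2 h2|e1 h1 e2 h2] /=.
- exact: differentiable_cst.
- exact: differentiable_coord.
- exact: differentiableD.
- exact: differentiableM.
Qed.

Lemma continuous_peval e : continuous (peval e).
Proof. by move=> x; exact/differentiable_continuous/differentiable_peval. Qed.

Lemma derive_peval e v : (fun x => 'D_v (peval e) x) = peval (pderive v e).
Proof.
apply/funext => x; elim: e => [c|i|e1 h1 e2 h2|e1 h1 e2 h2] /=.
- exact: derive_cst.
- rewrite deriveE; last exact: differentiable_coord.
  have lin : linear (fun y : 'rV[R]_m.+1 => y 0 i : R).
    by move=> t y z; rewrite !mxE.
  pose linM := GRing.isLinear.Build _ _ _ _ _ lin.
  pose f : {linear 'rV[R]_m.+1 -> R} :=
    HB.pack (fun y : 'rV[R]_m.+1 => y 0 i) linM.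
  by rewrite -[RHS]/(f v) -(diff_lin x (f := f)) //; exact: coord_continuous.
- rewrite -h1 -h2 -deriveD //; exact/diff_derivable/differentiable_peval.
- rewrite -h1 -h2 -[LHS]/('D_v (peval e1 * peval e2) x).
  by rewrite deriveM //; exact/diff_derivable/differentiable_peval.
Qed.

Lemma smooth_peval U e : smooth U (peval e).
Proof.
move=> k; elim: k e => [|k IH] e /=.
  by move=> x _; exact: continuous_peval.
split=> [x _|v]; first exact: differentiable_peval.
by rewrite derive_peval.
Qed.

Lemma open_peval_gt0 e : open [set x | 0 < peval e x].
Proof.
apply: (@open_comp _ _ (peval e) [set y | 0 < y]); last exact: open_gt.
by move=> x _; exact: continuous_peval.
Qed.

Lemma polynomial_submanifold d c (es : 'I_c -> pexpr) (S U : set 'rV[R]_m.+1) :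
  (d + c = m.+1)%N -> open U ->
  S = [set x | U x /\ forall i, peval (es i) x = 0] ->
  (forall x, S x -> forall v : 'rV[R]_c,
     (forall j, \sum_i v 0 i * peval (pderive (delta_mx 0 j) (es i)) x = 0) ->
     v = 0) ->
  submanifold d S.
Proof.
move=> dc oU eS indep x Sx; exists c, (fun i => peval (es i)), U; split=> //.
- by split=> //; move: Sx; rewrite eS => -[].
- by move=> i; exact: smooth_peval.
- apply: inj_row_free => v vJ; apply: (indep x Sx) => j.
  have /matrixP/(_ 0 j) := vJ; rewrite [LHS]mxE [RHS]mxE => E.
  by rewrite -[RHS]E; apply: eq_bigr => i _; rewrite mxE -derive_peval.
- by rewrite eS; apply/seteqP; split=> [y [[Uy H] _]|y [Uy H]].
Qed.

End Polynomials.

(** * Strata as pairs of ranks *)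

(** The ranks of the two forms [M1] and [M2]. *)
Definition stratum_ranks (s : stratum) : nat * nat :=
  match s with
  | S0 => (0, 1) | S0' => (1, 0) | S1 => (0, 2) | S1' => (2, 0)
  | S2 => (1, 1) | S3 => (1, 2) | S3' => (2, 1) | S4 => (2, 2)
  end.

Definition ranks_le (u v : nat * nat) : bool :=
  (u.1 <= v.1)%N && (u.2 <= v.2)%N.

Lemma stratum_ranks_inj : injective stratum_ranks.
Proof. by case; case. Qed.

Lemma stratum_of_ranks i j : (i <= 2)%N -> (j <= 2)%N -> (0 < i + j)%N ->
  exists s, stratum_ranks s = (i, j).
Proof.
case: i => [|[|[|]]] // _; case: j => [|[|[|]]] // _ _.
- by exists S0.
- by exists S1.
- by exists S0'.
- by exists S2.
- by exists S3.
- by exists S1'.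
- by exists S3'.
- by exists S4.
Qed.

(** If the conditions of [s] say that the ranks are at most those of [s], and
    all ranks occur, then inclusion of loci is the order on ranks; removing the
    smaller loci leaves the points whose ranks are those of [s]. *)
Lemma remove_smaller_ranks T (X : set T) (rho : T -> nat * nat)
    (V : stratum -> set T) :
  (forall s x, V s x <-> X x /\ ranks_le (rho x) (stratum_ranks s)) ->
  (forall s, exists2 x, X x & rho x = stratum_ranks s) ->
  (forall x, X x -> exists s, rho x = stratum_ranks s) ->
  forall s, remove_smaller V s = [set x | X x /\ rho x = stratum_ranks s].
Proof.
move=> VP ex cov s; rewrite /remove_smaller.
have le_refl u : ranks_le u u by rewrite /ranks_le !leqnn.
have le_trans u v w : ranks_le u v -> ranks_le v w -> ranks_le u w.
  move=> /andP[a b] /andP[c d].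
  by rewrite /ranks_le (leq_trans a c) (leq_trans b d).
have le_anti u v : ranks_le u v -> ranks_le v u -> u = v.
  case: u v => [a b] [c d] /andP[/= ac bd] /andP[/= ca db].
  by congr (_, _); apply/eqP; rewrite eqn_leq ?ac ?bd.
apply/seteqP; split=> x /=.
  move=> [/VP[Xx xs] nV]; split=> //; have [t xt] := cov x Xx.
  apply: contrapT => ne; apply: nV; exists t; last by apply/VP; rewrite xt.
  rewrite /= properEneq; split.
    have [z Xz zs] := ex s; apply/eqP => Vts.
    have : V s z by apply/VP; rewrite zs.
    rewrite -Vts => /VP[_]; rewrite zs => st.
    by apply: ne; apply: le_anti => //; rewrite xt.
  move=> z /VP[Xz zt]; apply/VP; split=> //.
  by apply: le_trans zt _; rewrite -xt.
move=> [Xx xs]; split; first by apply/VP; rewrite xs.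
move=> [t /= [_ Vt] /VP[_]]; rewrite xs => st; apply: Vt => z /VP[Xz zs].
by apply/VP; split=> //; exact: le_trans st.
Qed.

(** * The reduced space and its partition by ranks *)
Section ReducedSpace.
Variable R : realType.
Implicit Types y w : 'rV[R]_4.

Definition rank1 y := form_rank (coordA y) (coordB y) (coordD y).
Definition rank2 y :=
  form_rank (1 - coordA y) (coordP y - coordB y) (- coordD y).

Lemma reduced_spaceE y : reduced_space y <->
  psd (coordA y) (coordB y) (coordD y) /\
  psd (1 - coordA y) (coordP y - coordB y) (- coordD y).
Proof.
rewrite !psdE sqrrN /reduced_space /=; split.
  by move=> [/andP[? ?] /andP[? ?] ? ?]; do !split=> //; lra.
by move=> [[? ? ?] [? ? ?]]; split=> //; apply/andP; split; lra.
Qed.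

Lemma psd_rank0E (a b d : R) :
  psd a b d /\ form_rank a b d = 0%N <-> [/\ a = 0, b = 0 & d = 0].
Proof.
split=> [[p r]|E]; first by apply/(form_rank_eq0 p); rewrite r.
have p : psd a b d by case: E => -> -> ->; split; lra.
by split=> //; apply/eqP; rewrite -leqn0; apply/(form_rank_eq0 p).
Qed.

Lemma psd_rank1E (a b d : R) :
  psd a b d /\ form_rank a b d = 1%N <-> 0 < a + b /\ d ^+ 2 = a * b.
Proof.
rewrite /psd /form_rank; split=> [[[ab dab]]|[ab ->]].
  have [ab0|ab0] := ltP 0 (a + b); have [lt|ge] := ltP (d ^+ 2) (a * b) => // _.
    by split=> //; lra.
  by move: lt; have := sqr_ge0 d; nra.
by rewrite ab ltxx lexx ltW.
Qed.

Lemma psd_rank2E (a b d : R) :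
  psd a b d /\ form_rank a b d = 2%N <-> 0 < a + b /\ d ^+ 2 < a * b.
Proof.
rewrite /psd /form_rank; split=> [[[ab dab]]|[ab lt]].
  by case: (0 < a + b); case: (d ^+ 2 < a * b).
by rewrite ab lt !ltW.
Qed.

Definition rank_stratum i j : set 'rV[R]_4 :=
  [set y | reduced_space y /\ (rank1 y, rank2 y) = (i, j)].

Lemma rank_stratumE i j y : rank_stratum i j y <->
  (psd (coordA y) (coordB y) (coordD y) /\ rank1 y = i) /\
  (psd (1 - coordA y) (coordP y - coordB y) (- coordD y) /\ rank2 y = j).
Proof.
rewrite /rank_stratum /= reduced_spaceE.
by split=> [[[? ?] [-> ->]]|[[? ->] [? ->]]].
Qed.

(** The forms are not both zero, as their sum [diag(1, P)] is not. *)
Lemma ranks_stratum y : reduced_space y ->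
  exists s, (rank1 y, rank2 y) = stratum_ranks s.
Proof.
move=> /reduced_spaceE[p q].
have [||| s es] := @stratum_of_ranks (rank1 y) (rank2 y).
- exact: form_rank_le2.
- exact: form_rank_le2.
- rewrite lt0n addn_eq0; apply/negP => /andP[/eqP r1 /eqP r2].
  have [a0 _ _] := (psd_rank0E _ _ _).1 (conj p r1).
  have [a1 _ _] := (psd_rank0E _ _ _).1 (conj q r2).
  by move: a1; rewrite a0; lra.
by exists s; rewrite es.
Qed.

Lemma image_locusE s y : image_locus s y <->
  reduced_space y /\ ranks_le (rank1 y, rank2 y) (stratum_ranks s).
Proof.
suff H : reduced_space y ->
    (image_locus s y <-> ranks_le (rank1 y, rank2 y) (stratum_ranks s)).
  split=> [[Ry l]|[Ry /(H Ry)//]].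
  by split=> //; apply/(H Ry).
move=> Ry; have [p q] := (reduced_spaceE y).1 Ry.
have r1 := form_rank_le2 (coordA y) (coordB y) (coordD y).
have r2 := form_rank_le2 (1 - coordA y) (coordP y - coordB y) (- coordD y).
have p0 := form_rank_eq0 p; have p1 := form_rank_le1 p.
have q0 := form_rank_eq0 q; have q1 := form_rank_le1 q.
rewrite /ranks_le /rank1 /rank2 /image_locus /=.
move: p q r1 r2 p0 p1 q0 q1; rewrite !psdE sqrrN.
set A := coordA y; set B := coordB y; set P := coordP y; set D := coordD y.
set i := form_rank A B D; set j := form_rank _ _ _.
move=> [A0 B0 DAB] [A1 BP DAP] r1 r2 p0 p1 q0 q1.
case: s => /=;
  (split=> [[_ H]|/andP[H1 H2]]; [apply/andP; split=> //|split=> //]).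
- by apply/p0; case: H.
- by apply/q1; case: H => -> -> -> ->; ring.
- have [a b d] := p0.1 H1; have := q1.1 H2; rewrite a b d => e.
  by split=> //; lra.
- by apply/p1; case: H => -> -> _ ->; ring.
- by apply/q0; case: H => -> -> -> ->; split; ring.
- have [a b d] := q0.1 H2; have := p1.1 H1.
  have -> : A = 1 by lra.
  have -> : D = 0 by lra.
  by move=> e; split; lra.
- by apply/p0; case: H.
- by case: (p0.1 H1).
- by apply/q0; case: H => -> -> ->; split; ring.
- by have [a b d] := q0.1 H2; split; lra.
- by apply/p1; case: H.
- by apply/q1; case: H => -> ->.
- by have := p1.1 H1; have := q1.1 H2 => <- <-.
- exact/p1.
- exact/p1.
- exact/q1.
- exact/q1.
Qed.

Lemma form_rank_diag (a b : R) : 0 <= a -> 0 <= b ->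
  psd a b 0 /\ form_rank a b 0 = ((0 < a)%R + (0 < b)%R)%N.
Proof.
move=> a0 b0; split; first by split; [lra|rewrite expr0n mulr_ge0].
rewrite /form_rank expr0n /=.
have [a1|] := ltP 0 a; last first.
  move=> a1; have -> : a = 0 by lra.
  by rewrite add0r mul0r ltxx addn0.
by rewrite ltr_pwDl // pmulr_rgt0.
Qed.

Lemma coord_row4 (a b c d : R) :
  [/\ coordA (row4 a b c d) = a, coordB (row4 a b c d) = b,
     coordP (row4 a b c d) = c & coordD (row4 a b c d) = d].
Proof. by rewrite /coordA /coordB /coordP /coordD !mxE. Qed.

Lemma rank_stratum_diag (a b c : R) : 0 <= a <= 1 -> 0 <= b <= c ->
  rank_stratum ((0 < a)%R + (0 < b)%R) ((a < 1)%R + (b < c)%R)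
    (row4 a b c 0).
Proof.
move=> /andP[a0 a1] /andP[b0 bc]; apply/rank_stratumE.
rewrite /rank1 /rank2; have [-> -> -> ->] := coord_row4 a b c 0.
rewrite oppr0 -(subr_gt0 a) -(subr_gt0 b).
by split; apply: form_rank_diag => //; rewrite subr_ge0.
Qed.

(** The representatives have [D = 0], so that both forms are diagonal. *)
Lemma rank_stratum_nonempty s :
  rank_stratum (stratum_ranks s).1 (stratum_ranks s).2 !=set0.
Proof.
pose h : R := 2^-1.
have h0 : 0 < h by rewrite invr_gt0.
have h1 : h < 1 by rewrite /h; lra.
have [h0' h1'] := (ltW h0, ltW h1).
have ex (a b c : R) i j : 0 <= a <= 1 -> 0 <= b <= c ->
    (((0 < a)%R + (0 < b)%R)%N, ((a < 1)%R + (b < c)%R)%N) = (i, j) ->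
    rank_stratum i j !=set0.
  by move=> ? ? [<- <-]; exists (row4 a b c 0); exact: rank_stratum_diag.
case: s => /=.
- by apply: (ex 0 0 0); rewrite ?(h0, h1, h0', h1', ltr01, ler01, ltxx, lexx).
- by apply: (ex 1 0 0); rewrite ?(h0, h1, h0', h1', ltr01, ler01, ltxx, lexx).
- by apply: (ex 0 0 1); rewrite ?(h0, h1, h0', h1', ltr01, ler01, ltxx, lexx).
- by apply: (ex 1 1 1); rewrite ?(h0, h1, h0', h1', ltr01, ler01, ltxx, lexx).
- by apply: (ex h 0 0); rewrite ?(h0, h1, h0', h1', ltr01, ler01, ltxx, lexx).
- by apply: (ex h 0 1); rewrite ?(h0, h1, h0', h1', ltr01, ler01, ltxx, lexx).
- by apply: (ex h 1 1); rewrite ?(h0, h1, h0', h1', ltr01, ler01, ltxx, lexx).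
- by apply: (ex h h 1); rewrite ?(h0, h1, h0', h1', ltr01, ler01, ltxx, lexx).
Qed.

Lemma closure_ray (S : set 'rV[R]_4) y w :
  (forall t : R, 0 < t < 1 -> S (y + t *: w)) -> closure S y.
Proof.
move=> H B yB.
have cf : (fun t : R => y + t *: w) @ 0^'+ --> y.
  rewrite -[X in _ --> X]addr0 -(scale0r w); apply: cvg_at_right_filter.
  apply: cvgD; first exact: cvg_cst.
  apply: cvgZl; exact: cvg_id.
have BB : \forall t \near 0^'+, B (y + t *: w) by exact: cf.
have := filter_ex (filterI BB
  (filterI (nbhs_right_gt 0) (nbhs_right_lt (@ltr01 R)))).
move=> [t [Bt [t0 t1]]]; exists (y + t *: w); split=> //.
by apply: H; apply/andP.
Qed.

(** Lower semicontinuity of the rank, for [t] the trace and [d] the determinant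
    of a form. *)
Lemma rank_closure (S : set 'rV[R]_4) (t d : pexpr R 3) i y :
  (forall z, S z -> 0 < peval d z -> 0 < peval t z) ->
  (forall z, S z -> ((0 < peval t z)%R + (0 < peval d z)%R)%N = i) ->
  closure S y -> ((0 < peval t y)%R + (0 < peval d y)%R <= i)%N.
Proof.
move=> dt Si yS.
have meet (e : pexpr R 3) : 0 < peval e y -> exists2 z, S z & 0 < peval e z.
  move=> ey; have oe := @open_peval_gt0 R 3 e.
  by have [z [Sz ez]] := yS _ (open_nbhs_nbhs (conj oe ey)); exists z.
have [dy|_] := ltP 0 (peval d y).
  have [z Sz dz] := meet d dy; rewrite -(Si z Sz) dz (dt z Sz dz).
  by case: (_ < _).
have [ty|//] := ltP 0 (peval t y).
by have [z Sz tz] := meet t ty; rewrite -(Si z Sz) tz.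
Qed.

End ReducedSpace.

(** * The frontier condition *)
Section Frontier.
Variable R : realType.
Implicit Types y w : 'rV[R]_4.

Lemma coord_ray y (t a b c d : R) :
  [/\ coordA (y + t *: row4 a b c d) = coordA y + t * a,
      coordB (y + t *: row4 a b c d) = coordB y + t * b,
      coordP (y + t *: row4 a b c d) = coordP y + t * c &
      coordD (y + t *: row4 a b c d) = coordD y + t * d].
Proof. by rewrite /coordA /coordB /coordP /coordD !mxE. Qed.

(** Moving along this ray scales [M2] by [1 - t], while [M1] becomes
    [(1 - t) M1 + t diag(1, 1 + P)], which is positive definite. *)
Lemma raise1_full i j y : rank_stratum i j y -> closure (rank_stratum 2 j) y.
Proof.
move=> /rank_stratumE[[p _] [q rj]].
apply: (@closure_ray _ _ _ (row4 (1 - coordA y) (1 + coordP y - coordB y) 1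
  (- coordD y))) => t /andP[t0 t1].
apply/rank_stratumE; rewrite /rank1 /rank2.
have [-> -> -> ->] := coord_ray y t (1 - coordA y)
  (1 + coordP y - coordB y) 1 (- coordD y).
move: p q rj; rewrite /rank2.
set A := coordA y; set B := coordB y; set P := coordP y; set D := coordD y.
move=> p q rj.
have s0 : 0 < 1 - t by lra.
have P0 : 0 <= P by move: p q => /psdE[_ B0 _] /psdE[_ BP _]; lra.
split.
  have tP : 0 < t * (1 + P) by rewrite mulr_gt0 //; lra.
  have [p1 _] := psd_scale s0 p; have := psd_add_diag t0 tP p1.
  have -> : (1 - t) * A + t = A + t * (1 - A) by ring.
  have -> : (1 - t) * B + t * (1 + P) = B + t * (1 + P - B) by ring.
  by have -> : (1 - t) * D = D + t * - D by ring.
have := psd_scale s0 q; rewrite rj.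
have -> : (1 - t) * (1 - A) = 1 - (A + t * (1 - A)) by ring.
have -> : (1 - t) * (P - B) = P + t * 1 - (B + t * (1 + P - B)) by ring.
by have -> : (1 - t) * - D = - (D + t * - D) by ring.
Qed.

(** The same with the two forms exchanged. *)
Lemma raise2_full i j y : rank_stratum i j y -> closure (rank_stratum i 2) y.
Proof.
move=> /rank_stratumE[[p ri] [q _]].
apply: (@closure_ray _ _ _ (row4 (- coordA y) (- coordB y) 1 (- coordD y))).
move=> t /andP[t0 t1]; apply/rank_stratumE; rewrite /rank1 /rank2.
have [-> -> -> ->] := coord_ray y t (- coordA y) (- coordB y) 1 (- coordD y).
move: p q ri; rewrite /rank1.
set A := coordA y; set B := coordB y; set P := coordP y; set D := coordD y.
move=> p q ri.
have s0 : 0 < 1 - t by lra.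
have P0 : 0 <= P by move: p q => /psdE[_ B0 _] /psdE[_ BP _]; lra.
split.
  have := psd_scale s0 p; rewrite ri.
  have -> : (1 - t) * A = A + t * - A by ring.
  have -> : (1 - t) * B = B + t * - B by ring.
  by have -> : (1 - t) * D = D + t * - D by ring.
have tP : 0 < t * (1 + P) by rewrite mulr_gt0 //; lra.
have [q1 _] := psd_scale s0 q; have := psd_add_diag t0 tP q1.
have -> : (1 - t) * (1 - A) + t = 1 - (A + t * - A) by ring.
have -> : (1 - t) * (P - B) + t * (1 + P) = P + t * 1 - (B + t * - B) by ring.
by have -> : (1 - t) * - D = - (D + t * - D) by ring.
Qed.

(** When [M1] vanishes, [M2 = diag(1, P)]; transfer [diag(t, 0)] from [M2] to
    [M1]. *)
Lemma raise1_one j y : rank_stratum 0 j y -> closure (rank_stratum 1 j) y.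
Proof.
move=> /rank_stratumE[/psd_rank0E[A0 B0 D0] [q rj]].
apply: (@closure_ray _ _ _ (row4 1 0 0 0)) => t /andP[t0 t1].
apply/rank_stratumE; rewrite /rank1 /rank2.
have [-> -> -> ->] := coord_ray y t 1 0 0 0.
move: q rj; rewrite /rank2 A0 B0 D0 !(mulr0, mulr1, addr0, add0r, subr0, oppr0).
move=> /psdE[_ P0 _] <-.
have [_ ->] := form_rank_diag ler01 P0.
split.
  by have := form_rank_diag (ltW t0) (lexx 0); rewrite t0 ltxx.
have s0 : 0 < 1 - t by lra.
by have := form_rank_diag (ltW s0) P0; rewrite s0 ltr01.
Qed.

(** When [M2] vanishes, [M1 = diag(1, P)]; transfer [diag(t, 0)] from [M1] to
    [M2]. *)
Lemma raise2_one i y : rank_stratum i 0 y -> closure (rank_stratum i 1) y.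
Proof.
move=> /rank_stratumE[[p ri] /psd_rank0E[A1 BP D0]].
have {}A1 : coordA y = 1 by lra.
have {}D0 : coordD y = 0 by lra.
have {}BP : coordP y = coordB y by lra.
apply: (@closure_ray _ _ _ (row4 (- 1) 0 0 0)) => t /andP[t0 t1].
apply/rank_stratumE; rewrite /rank1 /rank2.
have [-> -> -> ->] := coord_ray y t (-1) 0 0 0.
move: p ri; rewrite /rank1 A1 BP D0 !(mulr0, mulrN1, addr0, oppr0, subrr).
move=> /psdE[_ B0 _] <-.
have [_ ->] := form_rank_diag ler01 B0.
have s0 : 0 < 1 - t by lra.
split.
  by have := form_rank_diag (ltW s0) B0; rewrite s0 ltr01.
rewrite (_ : 1 - (1 - t) = t); last by ring.
by have := form_rank_diag (ltW t0) (lexx 0); rewrite t0 ltxx.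
Qed.

Lemma rank_stratum_closure i j i' j' :
  (i <= i' <= 2)%N -> (j <= j' <= 2)%N ->
  rank_stratum i j `<=` closure (@rank_stratum R i' j').
Proof.
move=> /andP[ii i2] /andP[jj j2].
have up1 : @rank_stratum R i j `<=` closure (@rank_stratum R i' j).
  move=> y; move: ii; rewrite leq_eqVlt => /orP[/eqP <-|].
    exact: subset_closure.
  case: i' i2 => [|[|[|]]] // _; last by move=> _; exact: raise1_full.
  by rewrite ltnS leqn0 => /eqP ->; exact: raise1_one.
have up2 : @rank_stratum R i' j `<=` closure (@rank_stratum R i' j').
  move=> y; move: jj; rewrite leq_eqVlt => /orP[/eqP <-|].
    exact: subset_closure.
  case: j' j2 => [|[|[|]]] // _; last by move=> _; exact: raise2_full.
  by rewrite ltnS leqn0 => /eqP ->; exact: raise2_one.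
apply: subset_trans up1 _.
rewrite [X in _ `<=` X](closure_id _).1; last exact: closed_closure.
exact: closureS.
Qed.

Local Notation iA := (@Ordinal 4 0 isT).
Local Notation iB := (@Ordinal 4 1 isT).
Local Notation iP := (@Ordinal 4 2 isT).
Local Notation iD := (@Ordinal 4 3 isT).

Definition xA : pexpr R 3 := PVar R iA.
Definition xB : pexpr R 3 := PVar R iB.
Definition xP : pexpr R 3 := PVar R iP.
Definition xD : pexpr R 3 := PVar R iD.
Definition psub (e f : pexpr R 3) := PAdd e (PMul (PCst 3 (-1)) f).
Definition one_xA := psub (PCst 3 1) xA.
Definition xP_xB := psub xP xB.
Definition trM1 := PAdd xA xB.
Definition detM1 := psub (PMul xA xB) (PMul xD xD).
Definition trM2 := PAdd one_xA xP_xB.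
Definition detM2 := psub (PMul one_xA xP_xB) (PMul xD xD).

Lemma rank1E y : rank1 y = ((0 < peval trM1 y)%R + (0 < peval detM1 y)%R)%N.
Proof.
rewrite /rank1 /form_rank -[in LHS](subr_gt0 (coordD y ^+ 2)).
by rewrite /= mulN1r.
Qed.

Lemma rank2E y : rank2 y = ((0 < peval trM2 y)%R + (0 < peval detM2 y)%R)%N.
Proof.
rewrite /rank2 /form_rank sqrrN -[in LHS](subr_gt0 (coordD y ^+ 2)).
by rewrite /= !mulN1r.
Qed.

Lemma frontier_ranks i j y :
  reduced_space y -> closure (@rank_stratum R i j) y ->
  ranks_le (rank1 y, rank2 y) (i, j).
Proof.
move=> Ry cl; have pos z : rank_stratum i j z ->
    (0 < peval detM1 z -> 0 < peval trM1 z) /\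
    (0 < peval detM2 z -> 0 < peval trM2 z).
  move=> /rank_stratumE[[/psdE[a b _] _] [/psdE[c d _] _]].
  rewrite /= -/(coordA z) -/(coordB z) -/(coordP z) -/(coordD z).
  by split=> ?; nra.
rewrite /ranks_le /= rank1E rank2E; apply/andP; split.
  apply: (rank_closure _ _ cl) => z Sz; first exact: (pos z Sz).1.
  by rewrite -rank1E; case: Sz => _ [].
apply: (rank_closure _ _ cl) => z Sz; first exact: (pos z Sz).2.
by rewrite -rank2E; case: Sz => _ [].
Qed.

End Frontier.

(** * The strata of the reduced space are submanifolds *)
Section Strata.
Variable R : realType.
Implicit Types y : 'rV[R]_4.

Definition stratum_dim (s : stratum) : nat :=
  match s with
  | S0 => 0 | S0' => 0 | S1 => 1 | S1' => 1 | S2 => 2 | S3 => 3 | S3' => 3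
  | S4 => 4
  end.

(** The coefficients of a linear relation between the differentials are indexed
    by [nat] so that the sums over a concrete list compute. *)
Lemma list_submanifold d (es : seq (pexpr R 3)) (S U : set 'rV[R]_4) :
  (d + size es = 4)%N -> open U ->
  (forall y, S y <-> U y /\ all (fun e => peval e y == 0) es) ->
  (forall y, S y -> forall v : nat -> R,
     (forall j, \sum_(i < size es)
        v i * peval (pderive (delta_mx 0 j) (nth (PCst 3 0) es i)) y = 0) ->
     forall i, (i < size es)%N -> v i = 0) ->
  submanifold d S.
Proof.
move=> dc oU SE indep.
pose f (i : 'I_(size es)) := nth (PCst 3 0) es i.
apply: (@polynomial_submanifold R 3 d _ f S U) => //.
  apply/seteqP; split=> y; rewrite SE => -[Uy H]; split=> //.
    by move=> i; have /(all_nthP (PCst 3 0))/(_ i (ltn_ord i))/eqP := H.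
  by apply/(all_nthP (PCst 3 0)) => i li; apply/eqP; exact: (H (Ordinal li)).
move=> y Sy v H; apply/rowP => i; rewrite [RHS]mxE.
pose v' n := if insub n is Some m then v 0 m else 0 : R.
have v'E (m : 'I_(size es)) : v' m = v 0 m by rewrite /v' valK.
rewrite -v'E; apply: (indep y Sy) => // j.
by rewrite -[RHS](H j); apply: eq_bigr => m _; rewrite v'E.
Qed.

Ltac jacobian H :=
  have := H (@Ordinal 4 3 isT); have := H (@Ordinal 4 2 isT);
  have := H (@Ordinal 4 1 isT); have := H (@Ordinal 4 0 isT);
  rewrite !big_ord_recl !big_ord0 /= !mxE /bump /= ?add1n.

Ltac coords y :=
  rewrite /= -?/(coordA y) -?/(coordB y) -?/(coordP y) -?/(coordD y).

Lemma submanifold_01 : submanifold 0 (@rank_stratum R 0 1).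
Proof.
apply: (@list_submanifold 0 [:: xA R; xB R; xP R; xD R] _ setT) => //.
- exact: openT.
- move=> y; rewrite rank_stratumE psd_rank0E psd_rank1E; coords y.
  rewrite andbT; split.
    move=> [[-> -> ->] [_ e]]; rewrite !eqxx andbT /=; split=> //.
    by apply/eqP; move: e; lra.
  by move=> [_ /and4P[/eqP -> /eqP -> /eqP -> /eqP ->]]; do !split=> //; lra.
- move=> y Sy v H; jacobian H.
  by move=> e0 e1 e2 e3 [|[|[|[|i]]]] // _; lra.
Qed.

Lemma submanifold_10 : submanifold 0 (@rank_stratum R 1 0).
Proof.
apply: (@list_submanifold 0 [:: one_xA R; xB R; xP R; xD R] _ setT) => //.
- exact: openT.
- move=> y; rewrite rank_stratumE psd_rank0E psd_rank1E; coords y.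
  rewrite andbT mulN1r; split.
    move=> [[_ e] [A1 BP D0]]; move: e.
    have -> : coordA y = 1 by lra.
    have -> : coordD y = 0 by lra.
    have -> : coordP y = coordB y by lra.
    rewrite subrr mul1r expr0n /= => <-.
    by rewrite !eqxx.
  move=> [_ /and4P[/eqP A1 /eqP -> /eqP -> /eqP ->]].
  have -> : coordA y = 1 by lra.
  by do !split=> //; lra.
- move=> y Sy v H; jacobian H.
  by move=> e0 e1 e2 e3 [|[|[|[|i]]]] // _; lra.
Qed.

Lemma submanifold_02 : submanifold 1 (@rank_stratum R 0 2).
Proof.
apply: (@list_submanifold 1 [:: xA R; xB R; xD R] _
  [set y | 0 < peval (xP R) y]) => //.
- exact: open_peval_gt0.
- move=> y; rewrite rank_stratumE psd_rank0E psd_rank2E; coords y.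
  rewrite andbT; split.
    by move=> [[-> -> ->]]; rewrite !eqxx; split=> //; lra.
  by move=> [P0 /and3P[/eqP -> /eqP -> /eqP ->]]; split=> //; split; lra.
- move=> y Sy v H; jacobian H.
  by move=> e0 e1 e2 e3 [|[|[|i]]] // _; lra.
Qed.

Lemma submanifold_20 : submanifold 1 (@rank_stratum R 2 0).
Proof.
apply: (@list_submanifold 1 [:: one_xA R; xP_xB R; xD R] _
  [set y | 0 < peval (xP R) y]) => //.
- exact: open_peval_gt0.
- move=> y; rewrite rank_stratumE psd_rank0E psd_rank2E; coords y.
  rewrite andbT !mulN1r; split.
    move=> [[_ e] [A1 BP D0]]; move: e.
    have -> : coordA y = 1 by lra.
    have -> : coordD y = 0 by lra.
    have -> : coordP y = coordB y by lra.
    by rewrite !subrr !eqxx mul1r expr0n.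
  move=> [P0 /and3P[/eqP A1 /eqP BP /eqP D0]]; rewrite D0 A1 BP.
  have -> : coordA y = 1 by lra.
  have -> : coordB y = coordP y by lra.
  by do !split=> //; lra.
- move=> y Sy v H; jacobian H.
  by move=> e0 e1 e2 e3 [|[|[|i]]] // _; lra.
Qed.

(** The open set makes [M2] positive definite and [M1] nonzero, so that the sign
    conditions of semidefiniteness follow from [det M1 = 0]. *)
Lemma submanifold_12 : submanifold 3 (@rank_stratum R 1 2).
Proof.
apply: (@list_submanifold 3 [:: detM1 R] _ ([set y | 0 < peval (trM1 R) y] `&`
   ([set y | 0 < peval (trM2 R) y] `&` [set y | 0 < peval (detM2 R) y]))) => //.
- by do 2?apply: openI; exact: open_peval_gt0.
- move=> y; rewrite rank_stratumE psd_rank1E psd_rank2E; coords y.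
  rewrite andbT !mulN1r -!expr2 sqrrN subr_gt0 subr_eq0; split.
    by move=> [[? ->] [? ?]]; rewrite eqxx.
  by move=> [[? [? ?]] /eqP ?].
- move=> y; rewrite rank_stratumE psd_rank1E => -[[tr _] _] v H.
  jacobian H; coords y; move=> e0 e1 e2 e3 [|i] // _.
  apply/eqP; apply: contraTT tr => v0.
  have A0 : coordA y = 0 by apply: (mulfI v0); lra.
  have B0 : coordB y = 0 by apply: (mulfI v0); lra.
  by rewrite A0 B0 addr0 ltxx.
Qed.

Lemma submanifold_21 : submanifold 3 (@rank_stratum R 2 1).
Proof.
apply: (@list_submanifold 3 [:: detM2 R] _ ([set y | 0 < peval (trM2 R) y] `&`
   ([set y | 0 < peval (trM1 R) y] `&` [set y | 0 < peval (detM1 R) y]))) => //.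
- by do 2?apply: openI; exact: open_peval_gt0.
- move=> y; rewrite rank_stratumE psd_rank1E psd_rank2E; coords y.
  rewrite andbT !mulN1r -!expr2 sqrrN subr_gt0 subr_eq0; split.
    by move=> [[? ?] [? e]]; rewrite e eqxx -e.
  by move=> [[? [? ?]] /eqP ?].
- move=> y; rewrite rank_stratumE psd_rank1E => -[_ [tr _]] v H.
  jacobian H; coords y; move=> e0 e1 e2 e3 [|i] // _.
  apply/eqP; apply: contraTT tr => v0.
  have A1 : 1 - coordA y = 0 by apply: (mulfI v0); lra.
  have B0 : coordP y - coordB y = 0 by apply: (mulfI v0); lra.
  by rewrite A1 B0 addr0 ltxx.
Qed.

Lemma submanifold_22 : submanifold 4 (@rank_stratum R 2 2).
Proof.
apply: (@list_submanifold 4 [::] _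
   (([set y | 0 < peval (trM1 R) y] `&` [set y | 0 < peval (detM1 R) y]) `&`
    ([set y | 0 < peval (trM2 R) y] `&`
     [set y | 0 < peval (detM2 R) y]))) => //.
- by do 2?apply: openI; exact: open_peval_gt0.
- move=> y; rewrite rank_stratumE !psd_rank2E; coords y.
  by rewrite !mulN1r -!expr2 sqrrN !subr_gt0; split=> [|[]].
Qed.

(** As [det M2 - det M1 = (1 - A) P - B], both determinants vanish exactly when
    [B = (1 - A) P] and [D ^ 2 = A (1 - A) P].  On this surface, the open
    condition [P > 0] or [A (1 - A) > 0] excludes the two points where one form
    vanishes, and all points outside the reduced space. *)
Lemma submanifold_11 : submanifold 2 (@rank_stratum R 1 1).
Proof.
pose AA := PMul (xA R) (one_xA R).
apply: (@list_submanifold 2 [:: psub (xB R) (PMul (one_xA R) (xP R));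
     psub (PMul (xD R) (xD R)) (PMul AA (xP R))] _
   ([set y | 0 < peval (xP R) y] `|` [set y | 0 < peval AA y])) => //.
- by apply: openU; exact: open_peval_gt0.
- move=> y; split.
    move=> Sy; move: (Sy).
    move=> /rank_stratumE[[/psdE[A0 B0 _] _] [/psdE[A1 BP _] _]].
    move: Sy => /rank_stratumE; rewrite !psd_rank1E; coords y.
    rewrite !mulN1r -!expr2 sqrrN !subr_eq0 => -[[t1 d1] [t2 d2]].
    have eB : coordB y = (1 - coordA y) * coordP y by lra.
    split; last first.
      by rewrite andbT; apply/andP; split; apply/eqP; rewrite // d1 eB mulrA.
    have [P0|P0] := ltP 0 (coordP y); [by left|right].
    have P00 : coordP y = 0 by lra.
    have B00 : coordB y = 0 by lra.
    by apply: mulr_gt0; lra.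
  rewrite rank_stratumE !psd_rank1E; coords y.
  rewrite !mulN1r -!expr2 sqrrN !subr_eq0 andbT => -[U /andP[/eqP eB /eqP eD]].
  have D0 := sqr_ge0 (coordD y).
  rewrite eD eB; case: U => U.
    have A1 : 0 <= coordA y * (1 - coordA y) by rewrite -(pmulr_lge0 _ U) -eD.
    have [A0 A1'] : 0 <= coordA y /\ coordA y <= 1.
      by split; rewrite leNgt; apply/negP => lt; nra.
    have PA : 0 <= (1 - coordA y) * coordP y by apply: mulr_ge0; lra.
    split; split; [|ring| |ring].
      have [A2|A2] := ltP 0 (coordA y); first by lra.
      have -> : coordA y = 0 by lra.
      by lra.
    have [A2|A2] := ltP (coordA y) 1; first by nra.
    have -> : coordA y = 1 by lra.
    by lra.
  have P0 : 0 <= coordP y by rewrite -(pmulr_rge0 _ U) -eD.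
  have A0 : 0 < coordA y by nra.
  have A1 : coordA y < 1 by nra.
  by split; split; [nra|ring|nra|ring].
- move=> y; rewrite rank_stratumE.
  move=> [[/psdE[A0 B0 _] r1] [/psdE[A1 BP _] r2]] v H; jacobian H; coords y.
  move=> e0 e1 e2 e3.
  (* The derivatives along [B] are 1 and 0. *)
  have v0 : v 0%N = 0 by lra.
  case=> [|[|i]] // _; apply/eqP/negPn/negP => v1.
  move: e0 e2 e3; rewrite v0 => e0 e2 e3.
  have D0 : coordD y = 0 by apply: (mulfI v1); lra.
  have AA0 : coordA y * (1 - coordA y) = 0 by apply: (mulfI v1); lra.
  have PA : (1 - 2 * coordA y) * coordP y = 0 by apply: (mulfI v1); lra.
  have P0 : coordP y = 0.
    apply/eqP; apply: contraT => P0.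
    have /eqP : 1 - 2 * coordA y = 0 by apply: (mulIf P0); rewrite PA mul0r.
    by nra.
  have B00 : coordB y = 0 by lra.
  move: r1 r2; rewrite /rank1 /rank2 /form_rank B00 P0 D0.
  rewrite !subrr !mulr0 oppr0 expr0n /= ltxx !addn0 !addr0.
  by case: ltP => // a _; case: ltP => // b _; move: AA0; nra.
Qed.

Definition stratum_set s :=
  @rank_stratum R (stratum_ranks s).1 (stratum_ranks s).2.

Lemma submanifold_stratum s : submanifold (stratum_dim s) (stratum_set s).
Proof.
case: s.
- exact: submanifold_01.
- exact: submanifold_10.
- exact: submanifold_02.
- exact: submanifold_20.
- exact: submanifold_11.
- exact: submanifold_12.
- exact: submanifold_21.
- exact: submanifold_22.
Qed.

Lemma finite_stratum : finite_set [set: stratum].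
Proof.
rewrite (_ : [set: stratum] = [set S0; S0'; S1; S1'; S2; S3; S3'; S4]).
  by rewrite !finite_setU; do !split; exact: finite_set1.
apply/seteqP; split=> // -[] _; do 7?[by right|left] => //.
Qed.

Lemma stratum_dim_lt s t :
  s <> t -> ranks_le (stratum_ranks s) (stratum_ranks t) ->
  (stratum_dim s < stratum_dim t)%N.
Proof. by case: s; case: t. Qed.

Lemma reduced_space_stratification :
  stratification (@reduced_space R) stratum_set.
Proof.
split.
- exact: finite_stratum.
- apply/seteqP; split=> [y [s _ []] //|y Ry].
  have [s es] := ranks_stratum Ry; exists s => //.
  by split=> //; rewrite es; case: (stratum_ranks s).
- move=> s t _ _ [y [[_ es] [_ et]]]; apply: stratum_ranks_inj.
  move: es et.
  by case: (stratum_ranks s) (stratum_ranks t) => [a b] [c d] /= ->.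
exists stratum_dim; split=> [s|s t st [y [Sy cl]]].
  by split; [exact: rank_stratum_nonempty|exact: submanifold_stratum].
have [Ry ry] := Sy; have := frontier_ranks Ry cl.
rewrite ry -!surjective_pairing => le; split; last exact: stratum_dim_lt.
have [b1 b2] : ((stratum_ranks t).1 <= 2 /\ (stratum_ranks t).2 <= 2)%N.
  by case: (t).
by move: le => /andP[l1 l2]; apply: rank_stratum_closure; apply/andP.
Qed.

End Strata.

(** * The square root of a semidefinite form *)
Section SquareRoot.
Variable R : realType.
Implicit Types a b d : R.

(** The entries of the symmetric square root [(M + s) / t] of the matrix
    [M = [[a, d], [d, b]]], with [s ^ 2 = det M] and [t ^ 2 = tr M + 2 s].  At
    [M = 0] the quotients are [0 / 0 = 0], the right value. *)
Definition root_det a b d : R := Num.sqrt (a * b - d ^+ 2).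
Definition root_trace a b d : R := Num.sqrt (a + b + 2 * root_det a b d).
Definition root11 a b d : R := (a + root_det a b d) / root_trace a b d.
Definition root12 a b d : R := d / root_trace a b d.
Definition root22 a b d : R := (b + root_det a b d) / root_trace a b d.

Lemma root_trace_eq0 a b d : psd a b d -> root_trace a b d = 0 ->
  [/\ a = 0, b = 0 & d = 0].
Proof.
move=> /psdE[a0 b0 dab] /eqP; rewrite sqrtr_eq0 => t0.
have s0 : 0 <= root_det a b d by exact: sqrtr_ge0.
have ea : a = 0 by lra.
have eb : b = 0 by lra.
split=> //; apply/eqP; rewrite -sqrf_eq0; apply/eqP.
by move: dab (sqr_ge0 d); rewrite ea mul0r; lra.
Qed.

(** By the Cayley--Hamilton theorem, [M ^ 2 = tr M * M - s ^ 2], so that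
    [(M + s) ^ 2 = t ^ 2 M]. *)
Lemma root_sqr a b d : psd a b d ->
  [/\ root11 a b d ^+ 2 + root12 a b d ^+ 2 = a,
      root12 a b d ^+ 2 + root22 a b d ^+ 2 = b &
      root11 a b d * root12 a b d + root12 a b d * root22 a b d = d].
Proof.
move=> p; rewrite /root11 /root12 /root22.
have [t0|t0] := eqVneq (root_trace a b d) 0.
  have [-> -> ->] := root_trace_eq0 p t0.
  rewrite /root_det mulr0 expr0n subr0 sqrtr0 !addr0 !mul0r expr0n.
  by rewrite addr0.
have [a0 b0 dab] := (psdE a b d).1 p.
have s0 : 0 <= root_det a b d by exact: sqrtr_ge0.
have s2 : root_det a b d ^+ 2 = a * b - d ^+ 2 by rewrite sqr_sqrtr // subr_ge0.
have t2 : root_trace a b d ^+ 2 = a + b + 2 * root_det a b d.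
  by rewrite sqr_sqrtr //; lra.
have t20 : root_trace a b d ^+ 2 != 0 by rewrite expf_neq0.
move: s2 t2 t20 t0; set s := root_det a b d; set t := root_trace a b d.
move=> s2 t2 t20 t0; split.
- have -> : ((a + s) / t) ^+ 2 + (d / t) ^+ 2 =
      (a ^+ 2 + 2 * a * s + s ^+ 2 + d ^+ 2) / t ^+ 2 by field.
  by apply: (mulIf t20); rewrite divfK // s2 t2; ring.
- have -> : (d / t) ^+ 2 + ((b + s) / t) ^+ 2 =
      (b ^+ 2 + 2 * b * s + s ^+ 2 + d ^+ 2) / t ^+ 2 by field.
  by apply: (mulIf t20); rewrite divfK // s2 t2; ring.
- have -> : (a + s) / t * (d / t) + d / t * ((b + s) / t) =
      d * (a + b + 2 * s) / t ^+ 2 by field.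
  by rewrite -t2 mulfK.
Qed.

Section Limits.
Context {T : Type} {F : set_system T} {FF : Filter F}.
Variables (a b d : T -> R) (a0 b0 d0 : R).
Hypotheses (ca : a @ F --> a0) (cb : b @ F --> b0) (cd : d @ F --> d0).
Hypotheses (p0 : psd a0 b0 d0) (pF : \forall x \near F, psd (a x) (b x) (d x)).

Lemma cvg_sqrt (u : T -> R) (l : R) :
  u @ F --> l -> (fun x => Num.sqrt (u x)) @ F --> Num.sqrt l.
Proof.
by move=> ul; apply: (continuous_cvg _ _ ul); exact: sqrt_continuous.
Qed.

Let s x := root_det (a x) (b x) (d x).
Let t x := root_trace (a x) (b x) (d x).

Lemma cvg_root_det : s @ F --> root_det a0 b0 d0.
Proof.
by apply: cvg_sqrt; exact: (cvgB (cvgM ca cb) (cvgM cd cd)).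
Qed.

Lemma cvg_root_trace : t @ F --> root_trace a0 b0 d0.
Proof.
apply: cvg_sqrt.
apply: cvgD; first exact: cvgD.
by apply: cvgM; [exact: cvg_cst|exact: cvg_root_det].
Qed.

(** Where [t] does not vanish this is continuity of the quotient; at [M = 0] the
    entries are squeezed, as their squares are bounded by the trace of [M]. *)
Lemma cvg_root_entry (n : T -> R) (n0 : R) : n @ F --> n0 ->
  (forall x, psd (a x) (b x) (d x) -> (n x / t x) ^+ 2 <= a x + b x) ->
  (fun x => n x / t x) @ F --> n0 / root_trace a0 b0 d0.
Proof.
move=> cn le; have [t0|t0] := eqVneq (root_trace a0 b0 d0) 0; last first.
  by apply: cvgM => //; apply: cvgV => //; exact: cvg_root_trace.
rewrite t0 invr0 mulr0.
have [ea eb _] := root_trace_eq0 p0 t0.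
have c0 : (fun x => Num.sqrt (a x + b x)) @ F --> (0 : R).
  rewrite -[X in _ --> X]sqrtr0 -(addr0 0) -[X in X + _]ea -[X in _ + X]eb.
  apply: cvg_sqrt.
  exact: cvgD.
apply: (@squeeze_cvgr _ _ _ _ (fun x => - Num.sqrt (a x + b x))
  (fun x => Num.sqrt (a x + b x))) => //.
  apply: filterS pF => x px; rewrite -ler_norml -sqrtr_sqr ler_sqrt.
    exact: le.
  by have [] := px.
by rewrite -[X in _ --> X]oppr0; exact: cvgN.
Qed.

Lemma cvg_root : [/\
  (fun x => root11 (a x) (b x) (d x)) @ F --> root11 a0 b0 d0,
  (fun x => root12 (a x) (b x) (d x)) @ F --> root12 a0 b0 d0 &
  (fun x => root22 (a x) (b x) (d x)) @ F --> root22 a0 b0 d0].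
Proof.
have bound x : psd (a x) (b x) (d x) ->
    [/\ root11 (a x) (b x) (d x) ^+ 2 <= a x + b x,
        root12 (a x) (b x) (d x) ^+ 2 <= a x + b x &
        root22 (a x) (b x) (d x) ^+ 2 <= a x + b x].
  move=> px; have [e1 e2 _] := root_sqr px; have [a1 b1 _] := (psdE _ _ _).1 px.
  have := sqr_ge0 (root11 (a x) (b x) (d x)).
  have := sqr_ge0 (root12 (a x) (b x) (d x)).
  have := sqr_ge0 (root22 (a x) (b x) (d x)).
  by split; lra.
split; apply: cvg_root_entry => //.
- by apply: cvgD => //; exact: cvg_root_det.
- by move=> x /bound[].
- by move=> x /bound[].
- by apply: cvgD => //; exact: cvg_root_det.
- by move=> x /bound[].
Qed.

End Limits.

End SquareRoot.

(** * Limits of matrices *)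
Section MatrixLimits.
Variable R : realType.

Lemma cvg_mx_entries (T : Type) (F : set_system T) {FF : Filter F} m n
    (f : T -> 'M[R]_(m, n)) (M : 'M[R]_(m, n)) :
  (forall i j, (fun x => f x i j) @ F --> M i j) -> f @ F --> M.
Proof.
move=> H B [P MP sPB].
have : \forall x \near F, forall i, forall j, P i j (f x i j).
  apply: filter_forall => i; apply: filter_forall => j.
  exact: H (MP i j).
by apply: filterS => x Hx; exact: sPB.
Qed.

Lemma cvg_col_mx (T : Type) (F : set_system T) {FF : Filter F} m n p
    (u : T -> 'M[R]_(m, p)) (v : T -> 'M[R]_(n, p))
    (u0 : 'M[R]_(m, p)) (v0 : 'M[R]_(n, p)) :
  u @ F --> u0 -> v @ F --> v0 ->
  (fun z => col_mx (u z) (v z)) @ F --> col_mx u0 v0.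
Proof.
move=> cu cv; apply: cvg_mx_entries => i j; rewrite mxE.
under eq_fun do rewrite mxE.
case: (fintype.split i) => h.
  exact: (continuous_cvg _ (@coord_continuous R m p h j _) cu).
exact: (continuous_cvg _ (@coord_continuous R n p h j _) cv).
Qed.

Lemma continuous_dot (T : topologicalType) k (f g : T -> 'cV[R]_k) x :
  {for x, continuous f} -> {for x, continuous g} ->
  {for x, continuous (fun y => dot (f y) (g y))}.
Proof.
move=> cf cg; rewrite /dot /continuous_at.
apply: cvg_big => [|i _]; first exact: add_continuous.
have coord := @coord_continuous R k 1 i 0.
apply: cvgM; first exact: (continuous_cvg _ (coord _) cf).
exact: (continuous_cvg _ (coord _) cg).
Qed.

End MatrixLimits.

(** * The invariants and their section *)
Section PhaseSpace.
Variables (R : realType) (r r' : nat).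
Local Notation phase := ('cV[R]_(r + r') * 'cV[R]_(r + r'))%type.
Implicit Types x : phase.

Lemma phase_split x : x = (col_mx (q1 x) (q2 x), col_mx (p1 x) (p2 x)).
Proof. by case: x => q p; rewrite /q1 /q2 /p1 /p2 !vsubmxK. Qed.

Lemma cotangent_sphereE x : cotangent_sphere x <->
  dot (q1 x) (q1 x) + dot (q2 x) (q2 x) = 1 /\
  dot (q1 x) (p1 x) + dot (q2 x) (p2 x) = 0.
Proof.
by rewrite {1}[x]phase_split /cotangent_sphere /= enorm_eq1 !dot_col_mx.
Qed.

Lemma invariantsE x : invariants x =
  row4 (dot (q1 x) (q1 x)) (dot (p1 x) (p1 x))
    (dot (p1 x) (p1 x) + dot (p2 x) (p2 x)) (dot (q1 x) (p1 x)).
Proof. by rewrite /invariants !enorm_sqr (dotC (p1 x)). Qed.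

Lemma coord_invariants x : cotangent_sphere x ->
  [/\ coordA (invariants x) = dot (q1 x) (q1 x),
      coordB (invariants x) = dot (p1 x) (p1 x) &
      coordD (invariants x) = dot (q1 x) (p1 x)] /\
  [/\ 1 - coordA (invariants x) = dot (q2 x) (q2 x),
      coordP (invariants x) - coordB (invariants x) = dot (p2 x) (p2 x) &
      - coordD (invariants x) = dot (q2 x) (p2 x)].
Proof.
move=> /cotangent_sphereE[e1 e2]; rewrite invariantsE.
have [-> -> -> ->] := coord_row4 (dot (q1 x) (q1 x)) (dot (p1 x) (p1 x))
  (dot (p1 x) (p1 x) + dot (p2 x) (p2 x)) (dot (q1 x) (p1 x)).
by do 2!split=> //; lra.
Qed.

Definition phase_ranks x : nat * nat :=
  (pair_rank (q1 x) (p1 x), pair_rank (q2 x) (p2 x)).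

Lemma invariants_reduced x : cotangent_sphere x ->
  reduced_space (invariants x) /\
  (rank1 (invariants x), rank2 (invariants x)) = phase_ranks x.
Proof.
move=> /coord_invariants[[eA eB eD] [eA' eB' eD']].
rewrite reduced_spaceE /rank1 /rank2 eA' eB' eD' eA eB eD.
by split=> //; split; exact: psd_gram.
Qed.

Lemma row4_inj (y z : 'rV[R]_4) : coordA y = coordA z -> coordB y = coordB z ->
  coordP y = coordP z -> coordD y = coordD z -> y = z.
Proof.
rewrite /coordA /coordB /coordP /coordD => eA eB eP eD.
apply/rowP => -[[|[|[|[|m]]]] //= Hm].
- by rewrite (_ : Ordinal Hm = @Ordinal 4 0 isT) //; exact: val_inj.
- by rewrite (_ : Ordinal Hm = @Ordinal 4 1 isT) //; exact: val_inj.
- by rewrite (_ : Ordinal Hm = @Ordinal 4 2 isT) //; exact: val_inj.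
- by rewrite (_ : Ordinal Hm = @Ordinal 4 3 isT) //; exact: val_inj.
Qed.

(** The vector [(u, v, 0, ..., 0)]. *)
Definition plane_vector k (u v : R) : 'cV[R]_k :=
  \col_i (if val i == 0%N then u else if val i == 1%N then v else 0).

Lemma dot_plane k (u v u' v' : R) : (2 <= k)%N ->
  dot (plane_vector k u v) (plane_vector k u' v') = u * u' + v * v'.
Proof.
case: k => [|[|k]] // _; rewrite /dot !big_ord_recl big1 ?addr0 => [|i _].
  by rewrite !mxE.
by rewrite !mxE /= mul0r.
Qed.

Lemma cvg_plane_vector (T : Type) (F : set_system T) {FF : Filter F} k
    (u v : T -> R) (u0 v0 : R) : u @ F --> u0 -> v @ F --> v0 ->
  (fun z => plane_vector k (u z) (v z)) @ F --> plane_vector k u0 v0.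
Proof.
move=> cu cv; apply: cvg_mx_entries => i j; rewrite mxE.
under eq_fun do rewrite mxE.
by case: ifP => _ //; case: ifP => _ //; exact: cvg_cst.
Qed.

(** Two vectors whose coordinates are the columns of the root of [M] have Gram
    matrix [M]. *)
Definition root_section (y : 'rV[R]_4) : phase :=
  let A := coordA y in let B := coordB y in
  let P := coordP y in let D := coordD y in
  let A' := 1 - A in let B' := P - B in let D' := - D in
  (col_mx (plane_vector r (root11 A B D) (root12 A B D))
          (plane_vector r' (root11 A' B' D') (root12 A' B' D')),
   col_mx (plane_vector r (root12 A B D) (root22 A B D))
          (plane_vector r' (root12 A' B' D') (root22 A' B' D'))).

Hypotheses (hr : (2 <= r)%N) (hr' : (2 <= r')%N).

Lemma root_sectionK y : reduced_space y ->
  cotangent_sphere (root_section y) /\ invariants (root_section y) = y.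
Proof.
move=> /reduced_spaceE[p p'].
have [e1 e2 e3] := root_sqr p; have [e1' e2' e3'] := root_sqr p'.
rewrite cotangent_sphereE invariantsE /root_section /q1 /q2 /p1 /p2 /=.
rewrite !col_mxKu !col_mxKd !dot_plane // -!expr2 e1 e2 e3 e1' e2' e3'.
split; first by split; ring.
have [fA fB fP fD] := coord_row4 (coordA y) (coordB y)
  (coordB y + (coordP y - coordB y)) (coordD y).
by apply: row4_inj; rewrite ?fA ?fB ?fP ?fD //; ring.
Qed.

Lemma cvg_root_section (F : set_system 'rV[R]_4) {FF : Filter F}
    (y : 'rV[R]_4) :
  reduced_space y -> F --> y -> F (@reduced_space R) ->
  root_section @ F --> root_section y.
Proof.
move=> Ry Fy FR.
have coord i : (fun z : 'rV[R]_4 => z ord0 i) @ F --> y ord0 i.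
  exact: (continuous_cvg _ (@coord_continuous R 1 4 ord0 i y) Fy).
have [cA cB cP cD] : [/\ @coordA R @ F --> coordA y, @coordB R @ F --> coordB y,
   @coordP R @ F --> coordP y & @coordD R @ F --> coordD y].
  by split; exact: coord.
have cA' : (fun z => 1 - coordA z) @ F --> 1 - coordA y.
  by apply: cvgB => //; exact: cvg_cst.
have cB' : (fun z => coordP z - coordB z) @ F --> coordP y - coordB y.
  exact: cvgB.
have cD' : (fun z => - coordD z) @ F --> - coordD y by exact: cvgN.
have [p p'] := (reduced_spaceE y).1 Ry.
have [|c11 c12 c22] := cvg_root cA cB cD p.
  by apply: filterS FR => z /reduced_spaceE[].
have [|c11' c12' c22'] := cvg_root cA' cB' cD' p'.
  by apply: filterS FR => z /reduced_spaceE[].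
have cq := cvg_col_mx (cvg_plane_vector (k := r) c11 c12)
  (cvg_plane_vector (k := r') c11' c12').
have cp := cvg_col_mx (cvg_plane_vector (k := r) c12 c22)
  (cvg_plane_vector (k := r') c12' c22').
exact: (cvg_pair (cq FF FF FF) (cp FF FF FF)).
Qed.

Lemma continuous_root_section :
  {within @reduced_space R, continuous root_section}.
Proof.
apply/subspace_continuousP => y Ry; apply: cvg_root_section => //.
  exact: cvg_within.
exact: withinT.
Qed.

Lemma continuous_invariants : continuous (@invariants R r r').
Proof.
move=> x; rewrite /continuous_at.
have -> : @invariants R r r' = fun z =>
    row4 (dot (q1 z) (q1 z)) (dot (p1 z) (p1 z))
      (dot (p1 z) (p1 z) + dot (p2 z) (p2 z)) (dot (q1 z) (p1 z)).
  by apply/funext => z; exact: invariantsE.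
have cq : {for x, continuous (fun z : phase => z.1)} by exact: cvg_fst.
have cp : {for x, continuous (fun z : phase => z.2)} by exact: cvg_snd.
have sub k (f : 'I_k -> 'I_(r + r')) (g : phase -> 'cV[R]_(r + r'))
    (h : phase -> 'cV[R]_k) :
    (forall z i j, h z i j = g z (f i) j) ->
    {for x, continuous g} -> {for x, continuous h}.
  move=> hg cg; apply: cvg_mx_entries => i j; rewrite hg.
  under eq_fun do rewrite hg.
  exact: (continuous_cvg _ (@coord_continuous R _ _ (f i) j _) cg).
have cq1 : {for x, continuous (@q1 R r r')}.
  by apply: (sub r (lshift r') _ _ _ cq) => z i j; rewrite mxE.
have cp1 : {for x, continuous (@p1 R r r')}.
  by apply: (sub r (lshift r') _ _ _ cp) => z i j; rewrite mxE.
have cp2 : {for x, continuous (@p2 R r r')}.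
  by apply: (sub r' (@rshift r r') _ _ _ cp) => z i j; rewrite mxE.
apply: cvg_mx_entries => i j; rewrite mxE; under eq_fun do rewrite mxE.
case: j => [[|[|[|[|m]]]] Hm] //=.
- exact: continuous_dot.
- exact: continuous_dot.
- by apply: cvgD; exact: continuous_dot.
- exact: continuous_dot.
Qed.

End PhaseSpace.

(** * Orbits, isotropy types and strata *)
Section OrbitSpace.
Variables (R : realType) (r r' : nat).
Hypotheses (hr : (2 <= r)%N) (hr' : (2 <= r')%N).
Local Notation phase := ('cV[R]_(r + r') * 'cV[R]_(r + r'))%type.
Implicit Types x : phase.

Lemma act_blocks (h : 'M[R]_r * 'M[R]_r') x :
  [/\ q1 (act h x) = h.1 *m q1 x, q2 (act h x) = h.2 *m q2 x,
      p1 (act h x) = h.1 *m p1 x & p2 (act h x) = h.2 *m p2 x].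
Proof.
by rewrite /act {1}/q1 {2}/q2 {3}/p1 {4}/p2 /= !col_mxKu !col_mxKd.
Qed.

Lemma invariants_act (h : 'M[R]_r * 'M[R]_r') x : GR h ->
  invariants (act h x) = invariants x.
Proof.
move=> [ho1 ho2]; rewrite !invariantsE; have [-> _ -> ->] := act_blocks h x.
by rewrite !dot_orth.
Qed.

Lemma invariants_orbit x y : cotangent_sphere x -> cotangent_sphere y ->
  (invariants x = invariants y <-> exists2 g, GR g & y = act g x).
Proof.
move=> Cx Cy; split=> [e|[g Gg ->]]; last by rewrite invariants_act.
have [[xA xB xD] [xA' xB' xD']] := coord_invariants Cx.
have [[yA yB yD] [yA' yB' yD']] := coord_invariants Cy.
rewrite e in xA xB xD xA' xB' xD'.
have [||| g1 ho1 [e1 f1]] := @gram_orbit R _ (q1 x) (p1 x) (q1 y) (p1 y).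
- by rewrite -xA.
- by rewrite -xB.
- by rewrite -xD.
have [||| g2 ho2 [e2 f2]] := @gram_orbit R _ (q2 x) (p2 x) (q2 y) (p2 y).
- by rewrite -xA'.
- by rewrite -xB'.
- by rewrite -xD'.
exists (g1, g2); first by split.
by rewrite [LHS]phase_split /act /= e1 e2 f1 f2.
Qed.

(** A continuous section [u] of the invariants makes the reduced space carry the
    quotient topology: [V] is the preimage under [u] of its own preimage. *)
Lemma reduced_space_identifies : identifies_orbit_space r r' (@reduced_space R).
Proof.
split.
- apply/seteqP; split=> [_ [x Cx <-]|y Ry].
    by case: (invariants_reduced Cx).
  by have [Cy Iy] := root_sectionK hr hr' Ry; exists (root_section r r' y).
- exact: invariants_orbit.
move=> V VR; split=> /open_subspaceP[W oW WV]; apply/open_subspaceP.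
  exists (@invariants R r r' @^-1` W).
    by apply: open_comp => // x _; exact: continuous_invariants.
  apply/seteqP; split=> x [].
    move=> Wx Cx; split=> //; split=> //.
    have [Rx _] := invariants_reduced Cx.
    have : (W `&` @reduced_space R) (invariants x) by split.
    by rewrite WV => -[].
  move=> [Cx Vx] _; split=> //.
  have : (V `&` @reduced_space R) (invariants x) by split=> //; exact: VR.
  by rewrite -WV => -[].
have /open_subspaceP[U oU UW] :
    open (root_section r r' @^-1` W : set (subspace (@reduced_space R))).
  apply: open_comp => // y _; exact: continuous_root_section.
exists U => //; rewrite UW; apply/seteqP; split=> y [].
  move=> Wy Ry; split=> //; have [Cy Iy] := root_sectionK hr hr' Ry.
  have : (W `&` cotangent_sphere (n:=r + r')) (root_section r r' y) by split.
  by rewrite WV => -[[_]]; rewrite /= Iy.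
move=> Vy Ry; split=> //; have [Cy Iy] := root_sectionK hr hr' Ry.
have : ((cotangent_sphere (n:=r + r') `&` @invariants R r r' @^-1` V) `&`
    cotangent_sphere (n:=r + r')) (root_section r r' y).
  by do !split=> //; rewrite /= Iy.
by rewrite -WV => -[].
Qed.

Lemma isotropyE x : isotropy x =
  pair_stabilizer (q1 x) (p1 x) `*` pair_stabilizer (q2 x) (p2 x).
Proof.
apply/seteqP; split=> -[h1 h2] /=.
  move=> [[ho1 ho2]]; rewrite {2}[x]phase_split /act /= => -[].
  by move=> /eq_col_mx[? ?] /eq_col_mx[? ?].
move=> [[ho1 [e1 f1]] [ho2 [e2 f2]]]; split; first by split.
by rewrite [RHS]phase_split /act /= e1 e2 f1 f2.
Qed.

Lemma conj_setX (g1 : 'M[R]_r) (g2 : 'M[R]_r')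
    (H1 : set 'M[R]_r) (H2 : set 'M[R]_r') :
  [set (g1 *m h.1 *m invmx g1, g2 *m h.2 *m invmx g2) | h in H1 `*` H2] =
  conj_set g1 H1 `*` conj_set g2 H2.
Proof.
apply/seteqP; split.
  by move=> _ [[h1 h2] [/= H1h H2h] <-]; split; [exists h1|exists h2].
by move=> [c1 c2] [/= [h1 H1h <-] [h2 H2h <-]]; exists (h1, h2).
Qed.

Lemma setX_inj (T U : Type) (A A' : set T) (B B' : set U) :
  A !=set0 -> B !=set0 -> A `*` B = A' `*` B' -> A = A' /\ B = B'.
Proof.
move=> [a Aa] [b Bb] E; have [A'a B'b] : (A' `*` B') (a, b) by rewrite -E.
split; apply/seteqP; split=> c cc.
- by have [] : (A' `*` B') (c, b) by rewrite -E.
- by have [] : (A `*` B) (c, b) by rewrite E.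
- by have [] : (A' `*` B') (a, c) by rewrite -E.
- by have [] : (A `*` B) (a, c) by rewrite E.
Qed.

Lemma isotropy_typeE s : @isotropy_type R r r' s =
  orthogonal_corner (r - (stratum_ranks s).1) `*`
  orthogonal_corner (r' - (stratum_ranks s).2).
Proof. by case: s; rewrite /isotropy_type /= ?subn0. Qed.

Lemma isotropy_conj x i j : (i <= 2)%N -> (j <= 2)%N ->
  conjugate_subgroups (isotropy x)
    (orthogonal_corner (r - i) `*` orthogonal_corner (r' - j)) <->
  phase_ranks x = (i, j).
Proof.
move=> i2 j2; rewrite isotropyE.
have [g1 ho1 e1] := pair_stabilizer_conj (q1 x) (p1 x) hr.
have [g2 ho2 e2] := pair_stabilizer_conj (q2 x) (p2 x) hr'.
rewrite e1 e2; split.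
  move=> [[f1 f2] [/= O1 O2]]; rewrite conj_setX => /setX_inj[].
  - by exists (g1 *m 1%:M *m invmx g1), 1%:M => //; exact/corner1/leq_subr.
  - by exists (g2 *m 1%:M *m invmx g2), 1%:M => //; exact/corner1/leq_subr.
  have [[u1 _ _] [u2 _ _]] := (orthogonalV ho1, orthogonalV ho2).
  have [[v1 _ _] [v2 _ _]] := (orthogonalV O1, orthogonalV O2).
  have le1 := leq_trans (pair_rank_le2 (q1 x) (p1 x)) hr.
  have le2 := leq_trans (pair_rank_le2 (q2 x) (p2 x)) hr'.
  move=> /conj_corner_inj E1 /conj_corner_inj E2.
  congr (_, _); apply/eqP.
    rewrite -(eqn_sub2lE le1 (leq_trans i2 hr)).
    by apply/eqP/E1 => //; exact: leq_subr.
  rewrite -(eqn_sub2lE le2 (leq_trans j2 hr')).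
  by apply/eqP/E2 => //; exact: leq_subr.
move=> [-> ->]; exists (g1, g2); first by split.
by rewrite conj_setX.
Qed.

Lemma orbit_typeE s : orbit_type (@isotropy_type R r r' s) =
  [set x | cotangent_sphere x /\ phase_ranks x = stratum_ranks s].
Proof.
have [s1 s2] : ((stratum_ranks s).1 <= 2 /\ (stratum_ranks s).2 <= 2)%N.
  by case: s.
rewrite isotropy_typeE [stratum_ranks s]surjective_pairing.
by apply/seteqP; split=> x [Cx /(isotropy_conj x s1 s2)].
Qed.

Lemma pair_rank_le0 k (a b : 'cV[R]_k) :
  (pair_rank a b <= 0)%N <-> a = 0 /\ b = 0.
Proof.
rewrite /pair_rank form_rank_eq0; last exact: psd_gram.
split=> [[/dot_eq0 -> /dot_eq0 ->]|[-> ->]] //.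
by rewrite dot0l.
Qed.

Lemma pair_rank_le1 k (a b : 'cV[R]_k) :
  (pair_rank a b <= 1)%N <-> wedge a b = 0.
Proof. by rewrite /pair_rank form_rank_le1 ?wedge_eq0 //; exact: psd_gram. Qed.

(** This case turns [p = 0] into a condition on the rank when the other
    component of the position vanishes, so that [q] is a unit vector. *)
Lemma pair_rank_unit k (a b : 'cV[R]_k) : dot a a = 1 -> dot a b = 0 ->
  (pair_rank a b <= 1)%N <-> b = 0.
Proof.
move=> aa ab; rewrite /pair_rank form_rank_le1; last exact: psd_gram.
rewrite aa ab mul1r expr0n /=; split=> [/esym/dot_eq0|->] //.
by rewrite dot0l.
Qed.

Lemma vanishing_locusE s x : @vanishing_locus R r r' s x <->
  cotangent_sphere x /\ ranks_le (phase_ranks x) (stratum_ranks s).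
Proof.
suff H : cotangent_sphere x -> (@vanishing_locus R r r' s x <->
    ranks_le (phase_ranks x) (stratum_ranks s)).
  split=> [/[dup] -[Cx _] /(H Cx)|[Cx /(H Cx)]] //.
move=> Cx; have [e1 e2] := (cotangent_sphereE x).1 Cx.
have unit1 : q2 x = 0 -> p2 x = 0 ->
    (pair_rank (q1 x) (p1 x) <= 1)%N <-> p1 x = 0.
  move=> q p; apply: pair_rank_unit; first by rewrite -e1 q dot0l addr0.
  by rewrite -e2 q dot0l addr0.
have unit2 : q1 x = 0 -> p1 x = 0 ->
    (pair_rank (q2 x) (p2 x) <= 1)%N <-> p2 x = 0.
  move=> q p; apply: pair_rank_unit; first by rewrite -e1 q dot0l add0r.
  by rewrite -e2 q dot0l add0r.
have r1 := pair_rank_le2 (q1 x) (p1 x); have r2 := pair_rank_le2 (q2 x) (p2 x).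
have z1 := pair_rank_le0 (q1 x) (p1 x); have z2 := pair_rank_le0 (q2 x) (p2 x).
have w1 := pair_rank_le1 (q1 x) (p1 x); have w2 := pair_rank_le1 (q2 x) (p2 x).
rewrite /vanishing_locus /ranks_le /phase_ranks /=.
case: s => /=;
  (split=> [[_ H]|/andP[H1 H2]]; [apply/andP; split=> //|split=> //]).
- by apply/z1; case: H.
- by case: H => q p /(unit2 q p).
- by have [q p] := z1.1 H1; split=> //; apply/(unit2 q p).
- by case: H => q b p; apply/(unit1 q p).
- by apply/z2; case: H.
- by have [q p] := z2.1 H2; split=> //; apply/(unit1 q p).
- exact/z1.
- exact/z1.
- exact/z2.
- exact/z2.
- by apply/w1; case: H.
- by apply/w2; case: H.
- by split; [apply/w1|apply/w2].
- exact/w1.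
- exact/w1.
- exact/w2.
- exact/w2.
Qed.

Lemma phase_stratumE s : @phase_stratum R r r' s =
  [set x | cotangent_sphere x /\ phase_ranks x = stratum_ranks s].
Proof.
apply: remove_smaller_ranks => [t x|t|x Cx]; first exact: vanishing_locusE.
  have [y [Ry ry]] := rank_stratum_nonempty R t.
  have [Cy Iy] := root_sectionK hr hr' Ry; exists (root_section r r' y) => //.
  have [_ <-] := invariants_reduced Cy; rewrite Iy ry.
  by case: (stratum_ranks t).
have [Rx <-] := invariants_reduced Cx; exact: ranks_stratum.
Qed.

Lemma image_stratumE s : image_stratum s = @stratum_set R s.
Proof.
rewrite /image_stratum (@remove_smaller_ranks _ (@reduced_space R)
  (fun y => (rank1 y, rank2 y))).
- by rewrite /stratum_set /rank_stratum -surjective_pairing.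
- by move=> t y; exact: image_locusE.
- move=> t; have [y [Ry ry]] := rank_stratum_nonempty R t.
  by exists y; rewrite // ry; case: (stratum_ranks t).
- by move=> y; exact: ranks_stratum.
Qed.

Lemma invariants_stratum s :
  @invariants R r r' @`
    [set x | cotangent_sphere x /\ phase_ranks x = stratum_ranks s] =
  @stratum_set R s.
Proof.
apply/seteqP; split=> [_ [x [Cx rx] <-]|y [Ry ry]].
  have [Rx Ix] := invariants_reduced Cx; split=> //.
  by rewrite Ix rx; case: (stratum_ranks s).
have [Cy Iy] := root_sectionK hr hr' Ry; exists (root_section r r' y) => //.
  split=> //.
have [_ <-] := invariants_reduced Cy; rewrite Iy ry.
by case: (stratum_ranks s).
Qed.

End OrbitSpace.

Theorem proposition5p1 (R : realType) (r r' : nat)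
    (hr : (2 <= r)%N) (hr' : (2 <= r')%N) :
  [/\ @identifies_orbit_space R r r' (@reduced_space R),
      stratification (@reduced_space R)
        (fun s => @invariants R r r' @` orbit_type (@isotropy_type R r r' s))
    & forall s : stratum,
        @phase_stratum R r r' s = orbit_type (@isotropy_type R r r' s) /\
        @invariants R r r' @` @phase_stratum R r r' s = @image_stratum R s].
Proof.
split; first exact: reduced_space_identifies.
- rewrite (_ : (fun s => _) = @stratum_set R).
    exact: reduced_space_stratification.
  by apply/funext => s; rewrite orbit_typeE // invariants_stratum.
- move=> s; rewrite orbit_typeE // phase_stratumE //; split=> //.
  by rewrite invariants_stratum // image_stratumE.
Qed.
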